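(* For each even integer $c\ge 2$, let $\mathcal{P}_c$ be the Gauss–Legendre distribution (defined in the context) with smallest output $p_0$, and choose parameters $\eta_1=\eta_1(c)>0$, $\eta_2=\eta_2(c)>0$ and $\varepsilon_1=\varepsilon_1(c),\varepsilon_2=\varepsilon_2(c)\in(0,1)$ with $\lim_{c\to\infty}\eta_1=\eta\in(0,\infty)$, $\lim_{c\to\infty}\eta_2=\infty$, $\lim_{c\to\infty}\eta_2/c=\eta'\in[0,\infty)$, $\eta+\eta'<1$, and such that $\log(1/\varepsilon_2)/\log(1/\varepsilon_1)$ stays bounded as $c\to\infty$. Set $\mathcal{R}=\min_{1\le\ell\le c}\mathcal{R}_{\ell,\mathcal{P}_c}$, $\psi_1=\psi_2=\sigma(p_0)$, let $x_i>0$ be defined by $x_i r(x_i)=\eta_i\mathcal{R}\psi_1/c$ ($i=1,2$), let $A_i=\frac{c}{(1-\eta_1-\eta_2/c)\mathcal{R}}\cdot\frac{\psi_2}{x_i}\log\frac{1}{\varepsilon_i}$ and $m=A_1+A_2$. Then, as $c\to\infty$ through even integers, $$m\sim\frac{\pi}{(1-\eta-\eta')\,j_1\,x_\infty}\,c^2\log\frac{1}{\varepsilon_1},$$ i.e. the ratio of the two sides tends to $1$, where $x_\infty$ is the unique positive real with $x_\infty r(x_\infty)=\eta/(\pi j_1)$.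
   Context: A finite bias distribution is a probability distribution supported on a finite subset of $(0,1)$ that is symmetric (outputs $a$ and $1-a$ with equal probability); $E_p$ is expectation over its output $p$. $\sigma(p)=\sqrt{(1-p)/p}$; $f_{\ell,x}(p)=p^x(1-p)^{\ell-x}(x\sigma(p)-(\ell-x)\sigma(1-p))$; $R_{\ell,x}=\max\{0,E_p[f_{\ell,x}(p)]\}$; $\mathcal{R}_{\ell,\mathcal{P}}=E_p[-f_{\ell,0}(p)]-\sum_{x=1}^{\ell-1}\binom{\ell}{x}R_{\ell,x}$. $r(t)=(e^t-1-t)/t^2$ for $t>0$ (the map $t\mapsto t r(t)$ is a strictly increasing bijection $(0,\infty)\to(0,\infty)$). $\log$ is the natural logarithm. $j_1$ is the smallest positive zero of the Bessel function $J_0(t)=\sum_{i\ge0}(-1)^i(t/2)^{2i}/(i!)^2$. Gauss–Legendre distribution: for $c=2\nu$, let $\widetilde{L}_\nu(t)=\left.\left(\frac{d}{du}\right)^{\nu}(u^2-1)^{\nu}\right|_{u=2t-1}$; $\mathcal{P}_c$ takes as values the $\nu$ zeroes $p$ of $\widetilde L_\nu$, each with probability proportional to $\bigl((p(1-p))^{3/2}\widetilde L_\nu{}'(p)^2\bigr)^{-1}$. *)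

(* Defs.v *)
From HB Require Import structures.
From mathcomp Require Import all_boot all_order all_algebra.
From mathcomp Require Import all_classical all_reals all_analysis.
Set Implicit Arguments. Unset Strict Implicit. Unset Printing Implicit Defensive.
Import Order.TTheory GRing.Theory Num.Theory.
Import numFieldNormedType.Exports.
Local Open Scope classical_set_scope.
Local Open Scope ring_scope.

Section Defs.
Variable R : realType.

Definition sigma (p : R) : R := Num.sqrt ((1 - p) / p).

Definition fLX (l x : nat) (p : R) : R :=
  p ^+ x * (1 - p) ^+ (l - x) * (x%:R * sigma p - (l - x)%:R * sigma (1 - p)).

Definition Ltilde (nu : nat) : {poly R} :=
  ((('X ^+ 2 - 1) ^+ nu) ^`(nu)) \Po ('X *+ 2 - 1).

(* support of the Gauss-Legendre distribution P_c, c = 2 nu: the zeroes of Ltilde_nu *)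
Definition GLsupp (nu : nat) : set R := [set p | root (Ltilde nu) p].

Definition GLweight (nu : nat) (p : R) : R :=
  ((p * (1 - p)) `^ (3 / 2) * ((Ltilde nu)^`()).[p] ^+ 2)^-1.

Definition GLexp (nu : nat) (g : R -> R) : R :=
  (\sum_(p \in GLsupp nu) GLweight nu p * g p) / (\sum_(p \in GLsupp nu) GLweight nu p).

Definition GLp0 (nu : nat) : R :=
  xget 0 [set p | GLsupp nu p /\ forall q, GLsupp nu q -> p <= q].

Definition RLX (nu l x : nat) : R := Num.max 0 (GLexp nu (fLX l x)).

Definition calRl (nu l : nat) : R :=
  GLexp nu (fun p => - fLX l 0 p) - \sum_(1 <= x < l) 'C(l, x)%:R * RLX nu l x.

Definition calRmin (nu : nat) : R :=
  \big[Num.min/calRl nu 1]_(1 <= l < (nu.*2).+1) calRl nu l.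

Definition rfun (t : R) : R := (expR t - 1 - t) / t ^+ 2.

(* the positive solution x of x r(x) = y (t |-> t r(t) is a bijection (0,oo)->(0,oo)) *)
Definition trinv (y : R) : R := xget 0 [set t | 0 < t /\ t * rfun t = y].

Definition J0 (t : R) : R :=
  limn (series (fun i : nat => (-1) ^+ i * (t / 2) ^+ (2 * i) / ((i`!)%:R ^+ 2))).

Definition j1 : R :=
  xget 0 [set t | 0 < t /\ J0 t = 0 /\ forall s, 0 < s < t -> J0 s != 0].

End Defs.

Arguments calRmin {R}.
Arguments GLp0 {R}.
Arguments j1 {R}.

(* Main.v *)
Require Import Defs.
From HB Require Import structures.
From mathcomp Require Import all_boot all_order all_algebra.
From mathcomp Require Import all_classical all_reals all_analysis.
From mathcomp Require Import polyrcf ring lra zify.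
(* On (0,1) one has f_{l,x}(p) = sqrt(p(1-p)) d/dp [p^x (1-p)^(l-x)], and the
   Gauss-Legendre weight of a node, multiplied by sqrt(p(1-p)), is proportional
   to the Christoffel number of the nu-point Gauss quadrature on [0,1].  As that
   quadrature integrates the derivatives exactly for l <= 2 nu, every E[f_{l,x}]
   with 0 < x < l vanishes and all R_l are equal to 1 / Q(1/sqrt(p(1-p))), where
   Q is the quadrature sum.

   Q(1/sqrt(p(1-p))) tends to pi: writing u = 2p - 1, the truncations of
   (1-u^2)^(-1/2) = sum a_k u^(2k) minorise it and the short ones are integrated
   exactly; conversely u^(2k) = L(u)^2 S(u) + H(u) with deg H < 2 nu and S >= 0,
   because L^2 is, up to a positive constant, a product of factors u^2 - a
   with a >= 0, so the quadrature underestimates each moment.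

   The smallest node satisfies nu (nu+1) p_0 -> (j_1/2)^2 by the Mehler-Heine
   asymptotics: Ltilde(z / (nu (nu+1))) / Ltilde(0) converges to
   B(z) = J_0(2 sqrt z) with error O(1/nu), uniformly on compact sets, and B
   changes sign at its first zero since (z B')' = - B.  Hence R -> 1/pi,
   sigma(p_0) ~ c / j_1, and the rest is continuity of the inverse of t r(t),
   with x_2 -> oo making A_2 negligible. *)

Set Implicit Arguments. Unset Strict Implicit. Unset Printing Implicit Defensive.
Import Order.TTheory GRing.Theory Num.Theory.
Import numFieldNormedType.Exports.
Local Open Scope classical_set_scope.
Local Open Scope ring_scope.

(** * Integration of polynomials over [0,1] *)

Section PolynomialIntegral.
Variable R : rcfType.
Implicit Types (p q : {poly R}).

(** At i = 0 the division by [0%:R] yields 0, so this primitive vanishes at 0. *)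
Definition primitive p : {poly R} := \poly_(i < (size p).+1) (p`_i.-1 / i%:R).

Lemma deriv_primitive p : (primitive p)^`() = p.
Proof.
apply/polyP => i; rewrite coef_deriv coef_poly ltnS.
case: ltnP => [_|/(nth_default 0) ->]; last by rewrite mul0rn.
by rewrite /= -[LHS]mulr_natr divfK // pnatr_eq0.
Qed.

Lemma primitive_at0 p : (primitive p).[0] = 0.
Proof. by rewrite horner_coef0 coef_poly /= invr0 mulr0. Qed.

(** The integral over [0,1], defined algebraically so that it is available over any real closed
    field. *)
Definition pint p : R := (primitive p).[1].

Lemma pint_deriv p : pint p^`() = p.[1] - p.[0].
Proof.
set d := p - primitive p^`().
have d0 : d^`() = 0 by rewrite derivB deriv_primitive subrr.
have dE : d = (d`_0)%:P.
  apply/polyP => -[|i]; rewrite coefC //=.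
  have := congr1 (fun r : {poly R} => r`_i) d0.
  rewrite coef_deriv coef0 -[LHS]mulr_natr => /eqP.
  by rewrite mulf_eq0 pnatr_eq0 orbF => /eqP.
have e x : p.[x] = d`_0 + (primitive p^`()).[x].
  by have := congr1 (horner^~ x) dE; rewrite /= hornerD hornerN hornerC => <-; rewrite subrK.
by rewrite !e primitive_at0 addr0 addrC addKr.
Qed.

Lemma pint_linear_for (a : R) p q : pint (a *: p + q) = a * pint p + pint q.
Proof.
have -> : a *: p + q = (a *: primitive p + primitive q)^`().
  by rewrite derivD derivZ !deriv_primitive.
by rewrite pint_deriv !hornerE !primitive_at0 mulr0 addr0 subr0.
Qed.

Lemma pint0 : pint 0 = 0.
Proof. by rewrite -(derivC 0) pint_deriv !hornerC subrr. Qed.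

Lemma pintD p q : pint (p + q) = pint p + pint q.
Proof. by rewrite -[p]scale1r pint_linear_for mul1r scale1r. Qed.

Lemma pintZ a p : pint (a *: p) = a * pint p.
Proof. by rewrite -[_ *: _]addr0 pint_linear_for pint0 addr0. Qed.

Lemma pint_sum (I : Type) (r : seq I) (F : I -> {poly R}) :
  pint (\sum_(i <- r) F i) = \sum_(i <- r) pint (F i).
Proof. by elim/big_rec2: _ => [|i _ p _ <-]; rewrite ?pint0 ?pintD. Qed.

Lemma pint_by_parts p q :
  pint (p^`() * q) = p.[1] * q.[1] - p.[0] * q.[0] - pint (p * q^`()).
Proof. by rewrite -!hornerM -pint_deriv derivM pintD addrK. Qed.

(** By the mean value theorem the integral is a value of [p] at some point of [0,1]. *)
Lemma pint_ge0 p : (forall x, 0 <= x <= 1 -> 0 <= p.[x]) -> 0 <= pint p.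
Proof.
move=> p0; have [c cI] := poly_mvt (primitive p) (@ltr01 R).
rewrite primitive_at0 !subr0 mulr1 deriv_primitive /pint => ->.
by apply: p0; rewrite !(itvP cI).
Qed.

End PolynomialIntegral.

(** * Roots of iterated derivatives *)

Section IteratedRolle.
Variable R : rcfType.
Implicit Types (p : {poly R}) (s : seq R).

Lemma path_lt_last (a : R) s : path <%R a s -> a <= last a s.
Proof. by elim: s a => //= b s IH a /andP[/ltW ab /IH]; exact: le_trans. Qed.

Lemma rolle_path p a s : path <%R a s -> all (root p) (a :: s) ->
  exists t, [/\ size t = size s, sorted <%R t, all (root p^`()) t &
    all (fun x => a < x < last a s) t].
Proof.
elim: s a => [|b s IH] a; first by exists [::].
move=> /= /andP[ab bs] /and3P[ra rb rs].
have [t [st so rt lt]] := IH b bs (introT andP (conj rb rs)).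
have [c cI /eqP rc] : {c | c \in `]a, b[ & p^`().[c] = 0}.
  by apply: poly_rolle => //; rewrite (eqP ra) (eqP rb).
have [ac cb] : a < c /\ c < b by rewrite !(itvP cI).
exists (c :: t); split => /=; first by rewrite st.
- rewrite path_min_sorted //; apply: sub_all lt => x /andP[bx _].
  exact: lt_trans bx.
- by rewrite {1}/root rc.
have bl := path_lt_last bs.
rewrite ac (lt_le_trans cb bl) /=; apply: sub_all lt => x /andP[bx ->].
by rewrite (lt_trans ab bx).
Qed.

(** Each derivative removes at most one factor X - c. *)
Lemma root_derivn_factor (c : R) m (q : {poly R}) j : (j < m)%N ->
  root ((('X - c%:P) ^+ m * q)^`(j)) c.
Proof.
move=> jm; have [r ->] : exists r, (('X - c%:P) ^+ m * q)^`(j) =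
    ('X - c%:P) ^+ (m - j) * r.
  elim: j jm => [|j IH] jm; first by exists q; rewrite subn0.
  have [r e] := IH (ltnW jm); rewrite derivnS e.
  exists (r *+ (m - j) + ('X - c%:P) * r^`()).
  have -> : (m - j = (m - j.+1).+1)%N by lia.
  rewrite derivM deriv_exp derivXsubC /= mul1r exprS mulrnAl mulrDr mulrnAr.
  by congr (_ + _); rewrite mulrCA mulrA.
have -> : (m - j = (m - j.+1).+1)%N by lia.
by rewrite exprS -mulrA rootM root_XsubC eqxx.
Qed.

End IteratedRolle.

(** * Shifted Legendre polynomials *)

Section ShiftedLegendre.
Variable R : rcfType.
Implicit Types (p q : {poly R}).

Definition legbase (n : nat) : {poly R} := ('X ^+ 2 - 'X) ^+ n.

Lemma legbaseE n : legbase n = ('X - 0%:P) ^+ n * ('X - 1%:P) ^+ n.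
Proof. by rewrite -exprMn /legbase; congr (_ ^+ n); rewrite subr0; ring. Qed.

Lemma legbase_root0 n j : (j < n)%N -> root (legbase n)^`(j) 0.
Proof. by move=> jn; rewrite legbaseE root_derivn_factor. Qed.

Lemma legbase_root1 n j : (j < n)%N -> root (legbase n)^`(j) 1.
Proof. by move=> jn; rewrite legbaseE mulrC root_derivn_factor. Qed.

(** For j < n the j interior roots together with the roots 0 and 1 bound j + 1 gaps, and Rolle puts
    a root of the next derivative in each. *)
Lemma legbase_roots n j : (j <= n)%N -> exists t, [/\ size t = j,
  sorted <%R t, all (root (legbase n)^`(j)) t & all (fun x => 0 < x < 1) t].
Proof.
elim: j => [|j IH] jn; first by exists [::].
have [t [st so rt lt]] := IH (ltnW jn).
have := @rolle_path _ (legbase n)^`(j) 0 (rcons t 1).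
case.
- rewrite rcons_path path_min_sorted ?so /=; last first.
    by apply: sub_all lt => x /andP[].
  case/lastP: t lt {st so rt} => [|t x] /=; first by rewrite ltr01.
  by rewrite last_rcons all_rcons => /andP[/andP[]].
- by rewrite /= all_rcons rt legbase_root0 // legbase_root1.
move=> u [su sou ru lu]; exists u; split => //.
- by rewrite su size_rcons st.
- by move: lu; rewrite last_rcons.
Qed.

(** Repeated integration by parts moves the derivatives onto [q] until it vanishes; the boundary
    terms are zero because derivatives of order below n vanish at 0 and 1. *)
Lemma legbase_orthogonal n q : (size q <= n)%N ->
  pint ((legbase n)^`(n) * q) = 0.
Proof.
suff H j : (j <= n)%N -> forall q, (size q <= j)%N ->
    pint ((legbase n)^`(j) * q) = 0 by apply: H.
elim: j => [_ p|j IH jn p sp].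
  by rewrite size_poly_leq0 => /eqP ->; rewrite mulr0 pint0.
rewrite derivnS pint_by_parts (eqP (legbase_root0 jn)) (eqP (legbase_root1 jn)).
rewrite IH ?(ltnW jn) //; first by rewrite !mul0r !subr0.
have [->|p0] := eqVneq p 0; first by rewrite deriv0 size_poly0.
by rewrite -ltnS (leq_trans (lt_size_deriv p0)).
Qed.

Lemma legbase_coef n k :
  (legbase n)^`(n)`_k = (-1) ^+ (n + k) * ('C(n, k) * (n + k) ^_ n)%:R.
Proof.
rewrite coef_derivn; have -> : legbase n = ('X - 1%:P) ^+ n * 'X ^+ n.
  by rewrite -exprMn /legbase; congr (_ ^+ n); ring.
rewrite coefMXn ltnNge leq_addr /= addKn.
have -> : 'X - 1%:P = - 1%:P + 'X :> {poly R} by rewrite addrC.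
rewrite exprDn_comm ?coef_sum; last by rewrite /GRing.comm mulrC.
have t (i : 'I_n.+1) : ((- 1%:P) ^+ (n - i) * 'X ^+ i *+ 'C(n, i))`_k =
    (-1) ^+ (n - i) *+ 'C(n, i) * (k == i)%:R :> R.
  rewrite coefMn -polyCN -polyC_exp coefCM coefXn mulrnAl //.
under eq_bigr do rewrite t.
have [nk|kn] := ltnP n k.
  rewrite big1 ?bin_small // ?mul0rn ?mulr0 // => i _.
  by rewrite gtn_eqF ?mulr0 // (leq_trans _ nk) // ltnS -ltnS.
rewrite (bigD1 (Ordinal (kn : (k < n.+1)%N))) //= eqxx mulr1 big1 ?addr0.
  rewrite natrM mulrA !mulr_natr.
  congr (_ *+ _ *+ _); rewrite -signr_odd -[RHS]signr_odd.
  by congr (_ ^+ (_ : bool)); rewrite oddB // oddD.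
move=> i ik; suff -> : (k == i) = false by rewrite mulr0.
by apply: contraNF ik => /eqP e; apply/eqP/val_inj.
Qed.

End ShiftedLegendre.

(** * Gauss quadrature *)

Section GaussQuadrature.
Variables (R : rcfType) (L : {poly R}) (s : seq R).
Hypothesis s_uniq : uniq s.
Hypothesis s_root : all (root L) s.
Hypothesis L_size : size L = (size s).+1.
Hypothesis L_orth : forall q : {poly R}, (size q <= size s)%N -> pint (L * q) = 0.

Let L_neq0 : L != 0. Proof. by rewrite -size_poly_eq0 L_size. Qed.

(** Divided by L'(z) this is the Lagrange basis polynomial of the node z; [quad_weight] is its
    integral, the Christoffel number. *)
Definition cofactor_at (z : R) : {poly R} := L %/ ('X - z%:P).
Definition quad_weight (z : R) : R := pint (cofactor_at z) / L^`().[z].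

Let cofactorK z : z \in s -> L = cofactor_at z * ('X - z%:P).
Proof. by move=> zs; rewrite divpK // dvdp_XsubCl (allP s_root). Qed.

Let size_cofactor z : size (cofactor_at z) = size s.
Proof. by rewrite size_divp ?polyXsubC_eq0 // size_XsubC L_size subn1. Qed.

Let deriv_cofactor z : z \in s -> L^`().[z] = (cofactor_at z).[z].
Proof.
move=> zs; rewrite {1}(cofactorK zs) derivM derivXsubC !hornerE.
by rewrite subrr mulr0 add0r.
Qed.

Let cofactor_eq0 z y : z \in s -> y \in s -> y != z -> (cofactor_at z).[y] = 0.
Proof.
move=> zs ys yz; have /eqP := allP s_root y ys.
rewrite {1}(cofactorK zs) !hornerE => /eqP.
by rewrite mulf_eq0 [y - z == 0]subr_eq0 (negPf yz) orbF => /eqP.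
Qed.

(** If L'(z) = 0, the cofactor vanishes at every node; its degree is below their number, so it would
    be zero. *)
Lemma simple_roots z : z \in s -> L^`().[z] != 0.
Proof.
move=> zs; rewrite deriv_cofactor //; apply/negP => z0.
have : cofactor_at z = 0.
  apply: (@roots_geq_poly_eq0 _ _ s) => //; last by rewrite size_cofactor.
  apply/allP => y ys; have [->//|yz] := eqVneq y z.
  by rewrite rootE cofactor_eq0.
move=> /eqP; rewrite -size_poly_eq0 size_cofactor size_eq0 => /eqP e.
by rewrite e in zs.
Qed.

Let lagrange (r : {poly R}) : (size r <= size s)%N ->
  r = \sum_(z <- s) (r.[z] / L^`().[z]) *: cofactor_at z.
Proof.
move=> sr; apply/eqP; rewrite -subr_eq0; apply/eqP.
apply: (@roots_geq_poly_eq0 _ _ s) => //.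
  apply/allP => y ys; rewrite rootE hornerD hornerN horner_sum.
  rewrite (bigD1_seq y) //= big_seq_cond big1 ?addr0 => [|z /andP[zs zy]].
    by rewrite hornerZ -deriv_cofactor // divfK ?simple_roots // subrr.
  by rewrite hornerZ cofactor_eq0 ?mulr0 // eq_sym.
rewrite (leq_trans (size_polyD _ _)) // geq_max sr size_polyN.
rewrite (leq_trans (size_sum _ _ _)) //; apply/bigmax_leqP_seq => z _ _.
by rewrite (leq_trans (size_scale_leq _ _)) // size_cofactor.
Qed.

(** After division of [g] by L, the multiple of L integrates to 0 by orthogonality and vanishes at
    the nodes, while the remainder equals its Lagrange interpolant. *)
Lemma quadrature_exact (g : {poly R}) : (size g <= (size s).*2)%N ->
  pint g = \sum_(z <- s) quad_weight z * g.[z].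
Proof.
move=> sg; rewrite {1}(divp_eq g L) pintD [_ * L]mulrC L_orth ?add0r; last first.
  rewrite size_divp // L_size; move: sg; rewrite -addnn; move: (size g) => k; lia.
have sm : (size (g %% L)%R <= size s)%N.
  by rewrite -ltnS -L_size ltn_modp.
rewrite {1}(lagrange sm) pint_sum; apply: eq_big_seq => z zs.
have -> : g.[z] = (g %% L).[z].
  rewrite {1}(divp_eq g L) hornerD hornerM (eqP (allP s_root z zs)).
  by rewrite mulr0 add0r.
by rewrite pintZ /quad_weight; ring.
Qed.

(* Exactness on the derivatives of X(1-X)M^2 and X M^2, with M = L/(X-z), only
   sees the node z and determines its weight. *)
Lemma quad_weightE z : z \in s ->
  quad_weight z * (z * (1 - z) * L^`().[z] ^+ 2) = L.[1] ^+ 2.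
Proof.
move=> zs; set M := cofactor_at z.
have n0 : (0 < size s)%N by case: (s) zs.
have LE := cofactorK zs; rewrite -/M in LE.
have M_at : L^`().[z] = M.[z] by exact: deriv_cofactor.
have sM2 : (size (M ^+ 2) <= (size s).*2.-1)%N.
  rewrite expr2 (leq_trans (size_polyMleq _ _)) // size_cofactor; lia.
(* With n nodes, deg A <= 2 gives deg (A M^2) <= 2n, so the derivative is still integrated exactly.
   At the other nodes the double zero of M^2 kills it. *)
have red (A : {poly R}) : (size A <= 3)%N ->
    pint (A * M ^+ 2)^`() =
    quad_weight z * (A^`().[z] * M.[z] ^+ 2 + A.[z] * (M.[z] * M^`().[z] *+ 2)).
  move=> sA; rewrite quadrature_exact; last first.
    have [->|B0] := eqVneq (A * M ^+ 2) 0; first by rewrite deriv0 size_poly0.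
    rewrite -ltnS (leq_trans (lt_size_deriv B0)) //.
    rewrite (leq_trans (size_polyMleq _ _)) //; lia.
  rewrite (bigD1_seq z) //= big_seq_cond big1 ?addr0 => [|y /andP[ys yz]].
    by rewrite derivM deriv_exp !hornerE /= expr1; congr (_ * (_ + _)); ring.
  rewrite derivM deriv_exp !hornerE /= expr1 /M cofactor_eq0 //.
  by rewrite !(expr2,mul0r,mulr0,mul0rn,addr0).
have := red ('X * (1 - 'X)); have := red 'X.
rewrite !pint_deriv !poly.derivE !hornerE.
rewrite size_polyX => /(_ isT) e1.
have s3 : (size ('X * (1 - 'X) : {poly R})%R <= 3)%N.
  rewrite (leq_trans (size_polyMleq _ _)) // size_polyX.
  have -> : 1 - 'X = - ('X - 1%:P) :> {poly R} by rewrite opprB.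
  by rewrite size_polyN size_XsubC.
move=> /(_ s3) e2.
have -> : L.[1] = M.[1] * (1 - z) by rewrite {1}LE !hornerE.
rewrite M_at.
move: e1 e2; rewrite !(mul0r,subr0,subrr,mulr0,mul1r).
move: (quad_weight z) (M.[z]) (M^`().[z]) (M.[1]) => w a b c e1 e2.
rewrite /= in e1 e2 *.
(* The combination (1 - z)^2 [e1] - (1 - z) [e2] eliminates the unknown derivative [b]. *)
have -> : (c * (1 - z)) ^+ 2 = (1 - z) ^+ 2 * c ^+ 2 - (1 - z) * (0 * c * c) by ring.
by rewrite e1 e2; ring.
Qed.

End GaussQuadrature.

(** * Division of polynomials with non-negative coefficients *)

Section NonnegativeCoefficients.
Variable R : rcfType.
Implicit Types (f : {poly R}) (a : R).

Definition nonneg_coefs f := forall i, 0 <= f`_i.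

Lemma nonneg_coefs_horner f x : nonneg_coefs f -> 0 <= x -> 0 <= f.[x].
Proof.
move=> f0 x0; rewrite horner_coef; apply: sumr_ge0 => i _.
by rewrite mulr_ge0 ?exprn_ge0.
Qed.

(** Horner's scheme at a >= 0 only adds and multiplies non-negative numbers. The induction carries
    the sign of the remainder, which becomes a coefficient of the next quotient. *)
Lemma nonneg_coefs_div f a : 0 <= a -> nonneg_coefs f ->
  exists S c, f = ('X - a%:P) * S + c%:P /\ nonneg_coefs S.
Proof.
move=> a0; suff H n (g : {poly R}) : (size g <= n)%N -> nonneg_coefs g ->
  exists S c, [/\ g = ('X - a%:P) * S + c%:P, nonneg_coefs S & 0 <= c].
  by move=> /(H (size f) f (leqnn _))[S [c [-> S0 _]]]; exists S, c.
elim: n g => [g|n IH g sg g0].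
  rewrite size_poly_leq0 => /eqP -> _; exists 0, 0.
  by split; rewrite ?mulr0 ?addr0 // => i; rewrite coef0.
have [h [c e]] : exists h c, g = h * 'X + c%:P.
  by elim/poly_ind: g {sg g0} => [|h c _]; [exists 0, 0; rewrite mul0r addr0|exists h, c].
have h0 : nonneg_coefs h.
  by move=> i; have := g0 i.+1; rewrite e coefD coefMX coefC /= addr0.
have c0 : 0 <= c by have := g0 0%N; rewrite e coefD coefMX coefC /= add0r.
have sh : (size h <= n)%N.
  have [->|hn0] := eqVneq h 0; first by rewrite size_poly0.
  by move: sg; rewrite e size_MXaddC (negPf hn0).
have [S [d [eS S0 d0]]] := IH h sh h0.
exists (S * 'X + d%:P), (a * d + c); split.
- by rewrite e eS !polyCD polyCM; ring.
- by move=> [|i]; rewrite coefD coefMX coefC /= ?add0r ?addr0.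
- by rewrite addr_ge0 // mulr_ge0.
Qed.

(** Successive quotients are divided by one factor at a time; the remainders add up to a polynomial
    of degree below the number of factors. *)
Lemma nonneg_coefs_divs f (t : seq R) : all (fun a => 0 <= a) t ->
  nonneg_coefs f -> exists S H : {poly R},
  [/\ f = \prod_(a <- t) ('X - a%:P) * S + H, nonneg_coefs S &
      (size H <= size t)%N].
Proof.
elim: t f => [|a t IH] f /=; first by exists f, 0; rewrite big_nil mul1r addr0 size_poly0.
move=> /andP[a0 t0] f0; have [S [H [e S0 sH]]] := IH f t0 f0.
have [T [c [eT T0]]] := nonneg_coefs_div a0 S0.
exists T, (H + \prod_(b <- t) ('X - b%:P) * c%:P); split => //.
  by rewrite e eT big_cons; ring.
rewrite (leq_trans (size_polyD _ _)) // geq_max (leq_trans sH) //=.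
rewrite (leq_trans (size_polyMleq _ _)) // size_prod_XsubC.
by rewrite /= (leq_trans (leq_add (leqnn _) (size_polyC_leq1 c))) // addn1.
Qed.

End NonnegativeCoefficients.

(** * Composition with (2X - 1)^2 *)

Section CenteredSquare.
Variable R : rcfType.

Local Notation U2 := (('X *+ 2 - 1) ^+ 2 : {poly R}).

Lemma horner_U2 z : U2.[z] = (z *+ 2 - 1) ^+ 2.
Proof. by rewrite !hornerE. Qed.

Lemma size_U2_comp (f : {poly R}) n : (size f <= n)%N -> (size (f \Po U2) <= n.*2)%N.
Proof.
move=> sf; have [->|f0] := eqVneq f 0; first by rewrite comp_poly0 size_poly0.
have s2 : size ('X *+ 2 - 1 : {poly R}) = 2.
  have -> : 'X *+ 2 - 1 = 2%:P * 'X + (- 1)%:P :> {poly R}.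
    by rewrite mul_polyC scaler_nat polyCN.
  by rewrite size_MXaddC polyC_eq0 pnatr_eq0 /= size_polyC pnatr_eq0.
have := size_comp_poly f U2; rewrite size_exp s2 /=.
have : (0 < size f)%N by rewrite size_poly_gt0.
move: sf; move: (size (f \Po U2)) (size f) => u v; lia.
Qed.

End CenteredSquare.

(** * Gauss quadrature underestimates even moments *)

Section QuadratureUpperBound.
Variables (R : rcfType) (L : {poly R}) (s : seq R).
Hypothesis s_uniq : uniq s.
Hypothesis s_root : all (root L) s.
Hypothesis L_size : size L = (size s).+1.
Hypothesis L_orth : forall q : {poly R}, (size q <= size s)%N -> pint (L * q) = 0.
Hypothesis L_sym : L \Po (1 - 'X) = (-1) ^+ size s *: L.

Local Notation U2 := (('X *+ 2 - 1) ^+ 2 : {poly R}).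

Let L_factor : L = lead_coef L *: \prod_(z <- s) ('X - z%:P).
Proof. by apply: all_roots_prod_XsubC; rewrite ?uniq_rootsE. Qed.

(** Each factor is (2x - 1)^2 - (2z - 1)^2 = -4 (x - z)((1 - x) - z), so the product is a multiple
    of L(x) L(1 - x), which the symmetry turns into L(x)^2. *)
Lemma prod_nodes_U2 :
  \prod_(z <- s) (U2 - ((z *+ 2 - 1) ^+ 2)%:P) =
  (4 ^+ size s / lead_coef L ^+ 2) *: L ^+ 2.
Proof.
have lc0 : lead_coef L != 0 by rewrite lead_coef_eq0 -size_poly_eq0 L_size.
have e2 : (-1) ^+ size s *: L ^+ 2 = L * (L \Po (1 - 'X)).
  by rewrite L_sym -scalerAr expr2.
have -> : L ^+ 2 = (-1) ^+ size s *: (L * (L \Po (1 - 'X))).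
  by rewrite -e2 scalerA -exprMn mulrNN mulr1 expr1n scale1r.
rewrite {2 3}L_factor comp_polyZ rmorph_prod /=.
rewrite -scalerAl -scalerAr !scalerA -big_split /=.
have -> : 4 ^+ size s / lead_coef L ^+ 2 * (-1) ^+ size s * lead_coef L * lead_coef L = (- 4) ^+ size s.
  rewrite -[- 4]mulrN1 exprMn; field.
  by [].
elim: (s) => [|z t IH]; first by rewrite !big_nil expr0 scale1r.
rewrite !big_cons IH /= exprS -!mul_polyC.
rewrite comp_polyB comp_polyX comp_polyC !(polyCM, rmorphB, rmorphMn, rmorphXn, rmorph1, rmorphN, rmorph_nat) /=.
move: (\prod_(i <- t) _) => P.
rewrite [(-4) ^+ (size t).+1]exprS; move: ((- 4) ^+ size t : {poly R}) => c; ring.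
Qed.

(** The quadrature sees only the remainder [H], and integrates it exactly; the rest of the integrand
    is a non-negative multiple of L^2 [S]. *)
Lemma quadrature_upper (f : {poly R}) : nonneg_coefs f ->
  \sum_(z <- s) quad_weight L z * f.[(z *+ 2 - 1) ^+ 2] <= pint (f \Po U2).
Proof.
move=> f0.
have [|S [H [e S0 sH]]] := @nonneg_coefs_divs _ f [seq (z *+ 2 - 1) ^+ 2 | z <- s] _ f0.
  by apply/allP => _ /mapP[z _ ->]; rewrite sqr_ge0.
rewrite size_map in sH.
have -> : \sum_(z <- s) quad_weight L z * f.[(z *+ 2 - 1) ^+ 2] = pint (H \Po U2).
  rewrite (quadrature_exact s_uniq s_root L_size L_orth) ?size_U2_comp //.
  apply: eq_big_seq => z zs; rewrite horner_comp horner_U2 e hornerD hornerM.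
  suff -> : (\prod_(a <- [seq (z0 *+ 2 - 1) ^+ 2 | z0 <- s]) ('X - a%:P)).[(z *+ 2 - 1) ^+ 2] = 0.
    by rewrite mul0r add0r.
  by apply/eqP; rewrite -[_ == 0]/(root _ _) root_prod_XsubC; apply: (map_f (fun y => (y *+ 2 - 1) ^+ 2)).
rewrite e comp_polyD comp_polyM pintD lerDr; apply: pint_ge0 => x _.
rewrite big_map rmorph_prod /=.
under eq_bigr do rewrite comp_polyB comp_polyX comp_polyC.
rewrite prod_nodes_U2 hornerM horner_comp horner_U2 hornerZ horner_exp.
rewrite mulr_ge0 ?nonneg_coefs_horner ?sqr_ge0 //.
by rewrite mulr_ge0 ?sqr_ge0 // divr_ge0 ?sqr_ge0 ?exprn_ge0 ?ler0n.
Qed.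

End QuadratureUpperBound.

(** * The Gauss-Legendre distribution *)

Section GaussLegendre.
Variable R : realType.

Lemma derivn_comp_affine (p q : {poly R}) a n : q^`() = a%:P ->
  (p \Po q)^`(n) = a ^+ n *: (p^`(n) \Po q).
Proof.
move=> qa; elim: n => [|n IH]; first by rewrite scale1r.
by rewrite derivnS IH derivZ deriv_comp qa mulrC mul_polyC scalerA -exprSr.
Qed.

Lemma deriv1 : (1 : {poly R})^`() = 0.
Proof. exact: derivC. Qed.

(** With u = 2p - 1 one has u^2 - 1 = 4 (p^2 - p), while n derivatives in p produce 2^n; the
    quotient of 4^n by 2^n remains. *)
Lemma LtildeE n : Ltilde R n = 2 ^+ n *: (legbase R n)^`(n).
Proof.
have d : ('X *+ 2 - 1 : {poly R})^`() = 2%:P.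
  by rewrite derivB derivMn derivX deriv1 subr0 polyCMn.
have := @derivn_comp_affine (('X ^+ 2 - 1) ^+ n) _ _ n d.
have -> : (('X ^+ 2 - 1) ^+ n) \Po ('X *+ 2 - 1) = 4 ^+ n *: legbase R n.
  rewrite rmorphXn rmorphB rmorphXn rmorph1 /= comp_polyX /legbase.
  rewrite -mul_polyC rmorphXn -exprMn /=; congr (_ ^+ n).
  by rewrite (_ : 4%:P = 4) ?rmorph_nat //; ring.
rewrite derivnZ -[RHS]/(_ *: Ltilde R n) => e.
have two0 : 2 ^+ n != 0 :> R by rewrite expf_neq0 ?pnatr_eq0.
apply: (scalerI two0); rewrite -e scalerA -exprMn; congr (_ ^+ n *: _).
by rewrite -natrM.
Qed.

Lemma coef_Ltilde n k : (Ltilde R n)`_k =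
  2 ^+ n * ((-1) ^+ (n + k) * ('C(n, k) * (n + k) ^_ n)%:R).
Proof. by rewrite LtildeE coefZ legbase_coef. Qed.

Lemma size_Ltilde n : size (Ltilde R n) = n.+1.
Proof.
apply/eqP; rewrite eqn_leq; apply/andP; split.
  by apply/leq_sizeP => k nk; rewrite coef_Ltilde bin_small // mul0n !mulr0.
rewrite ltnNge; apply/negP => /leq_sizeP/(_ n (leqnn n))/eqP.
rewrite coef_Ltilde binn mul1n !mulf_eq0 expf_eq0 signr_eq0 !pnatr_eq0 andbF /=.
by apply/negP; rewrite -lt0n ffact_gt0 leq_addr.
Qed.

Lemma Ltilde_orth n (q : {poly R}) : (size q <= n)%N -> pint (Ltilde R n * q) = 0.
Proof. by move=> sq; rewrite LtildeE -scalerAl pintZ legbase_orthogonal ?mulr0. Qed.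

Lemma Ltilde_sym n : Ltilde R n \Po (1 - 'X) = (-1) ^+ n *: Ltilde R n.
Proof.
have d : (1 - 'X : {poly R})^`() = (- 1)%:P by rewrite derivB derivX deriv1 sub0r polyCN.
rewrite LtildeE comp_polyZ scalerA mulrC -scalerA; congr (_ *: _).
have := @derivn_comp_affine (legbase R n) _ _ n d.
have -> : legbase R n \Po (1 - 'X) = legbase R n.
  rewrite /legbase rmorphXn rmorphB rmorphXn /= comp_polyX; congr (_ ^+ n); ring.
by move=> e; rewrite [in RHS]e scalerA -exprMn mulrNN mulr1 expr1n scale1r.
Qed.

Lemma Ltilde_roots n : exists t, [/\ size t = n, sorted <%R t,
  all (root (Ltilde R n)) t & all (fun x => 0 < x < 1) t].
Proof.
have [t [st so rt lt]] := legbase_roots R (leqnn n).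
exists t; split => //; apply: sub_all rt => x rx.
by rewrite LtildeE rootZ // expf_neq0 ?pnatr_eq0.
Qed.

(** A choice of the increasing list of roots; [mem_GLnodes] shows that it contains all of them. *)
Definition GLnodes n : seq R := projT1 (cid (Ltilde_roots n)).

Lemma size_GLnodes n : size (GLnodes n) = n.
Proof. by rewrite /GLnodes; case: cid => t []. Qed.

Lemma sorted_GLnodes n : sorted <%R (GLnodes n).
Proof. by rewrite /GLnodes; case: cid => t []. Qed.

Lemma uniq_GLnodes n : uniq (GLnodes n).
Proof. exact: (sorted_uniq lt_trans ltxx (sorted_GLnodes n)). Qed.

Lemma root_GLnodes n : all (root (Ltilde R n)) (GLnodes n).
Proof. by rewrite /GLnodes; case: cid => t []. Qed.

Lemma GLnodes_itv n z : z \in GLnodes n -> 0 < z < 1.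
Proof. by rewrite /GLnodes; case: cid => t [_ _ _ /= /allP]; apply. Qed.

Lemma Ltilde_neq0 n : Ltilde R n != 0.
Proof. by rewrite -size_poly_eq0 size_Ltilde. Qed.

Lemma mem_GLnodes n z : (z \in GLnodes n) = root (Ltilde R n) z.
Proof.
apply/idP/idP => [|rz]; first exact: (allP (root_GLnodes n)).
apply/negPn/negP => zs.
have := @max_poly_roots _ _ (z :: GLnodes n) (Ltilde_neq0 n).
by rewrite /= rz root_GLnodes zs uniq_GLnodes size_Ltilde size_GLnodes ltnn => /(_ isT isT).
Qed.

Lemma Ltilde_at1_neq0 n : (Ltilde R n).[1] != 0.
Proof.
apply/negP; rewrite -[_ == 0]/(root _ _) -mem_GLnodes => /GLnodes_itv.
by rewrite ltxx andbF.
Qed.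

Lemma GLsuppE n : @GLsupp R n = [set` GLnodes n].
Proof. by apply/seteqP; split => z /=; rewrite mem_GLnodes. Qed.

Definition GLquad n (z : R) : R := quad_weight (Ltilde R n) z.

Let size_L n : size (Ltilde R n) = (size (GLnodes n)).+1.
Proof. by rewrite size_GLnodes size_Ltilde. Qed.

Let L_orth n (q : {poly R}) :
  (size q <= size (GLnodes n))%N -> pint (Ltilde R n * q) = 0.
Proof. by rewrite size_GLnodes; exact: Ltilde_orth. Qed.

Lemma GLquad_exact n (g : {poly R}) : (size g <= n.*2)%N ->
  \sum_(z <- GLnodes n) GLquad n z * g.[z] = pint g.
Proof.
move=> sg; rewrite (@quadrature_exact _ (Ltilde R n) (GLnodes n)) ?size_GLnodes //.
- exact: uniq_GLnodes.
- exact: root_GLnodes.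
- exact: size_Ltilde.
- exact: Ltilde_orth.
Qed.

Lemma GLquad_upper n (f : {poly R}) : nonneg_coefs f ->
  \sum_(z <- GLnodes n) GLquad n z * f.[(z *+ 2 - 1) ^+ 2] <=
  pint (f \Po ('X *+ 2 - 1) ^+ 2).
Proof.
by apply: quadrature_upper; rewrite ?uniq_GLnodes ?root_GLnodes ?size_GLnodes ?size_Ltilde //;
  [exact: Ltilde_orth|exact: Ltilde_sym].
Qed.

Lemma GLquadE n z : z \in GLnodes n ->
  GLquad n z = (Ltilde R n).[1] ^+ 2 / (z * (1 - z) * (Ltilde R n)^`().[z] ^+ 2).
Proof.
move=> zs; have /andP[z0 z1] := GLnodes_itv zs.
have d0 : (Ltilde R n)^`().[z] != 0.
  by apply: (@simple_roots _ _ (GLnodes n)); rewrite ?uniq_GLnodes ?root_GLnodes.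
rewrite -(@quad_weightE _ _ (GLnodes n) _ _ _ _ _ zs) //.
- by rewrite mulfK // !mulf_neq0 ?sqrf_eq0 ?subr_eq0 ?(gt_eqF z0) ?(gt_eqF z1) ?expf_neq0.
- exact: uniq_GLnodes.
- exact: root_GLnodes.
- exact: L_orth.
Qed.

Lemma GLquad_gt0 n z : z \in GLnodes n -> 0 < GLquad n z.
Proof.
move=> zs; have /andP[z0 z1] := GLnodes_itv zs.
have d0 : (Ltilde R n)^`().[z] != 0.
  by apply: (@simple_roots _ _ (GLnodes n)); rewrite ?uniq_GLnodes ?root_GLnodes.
have e2 : 0 < (Ltilde R n).[1] ^+ 2 by rewrite exprn_even_gt0 //= Ltilde_at1_neq0.
have d2 : 0 < (Ltilde R n)^`().[z] ^+ 2 by rewrite exprn_even_gt0.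
by rewrite GLquadE // divr_gt0 // mulr_gt0 // mulr_gt0 ?subr_gt0.
Qed.

(** The exponent 3/2 splits as 1 + 1/2: the integer part belongs to the Christoffel number and the
    half leaves the square root. *)
Lemma GLweightE n z : z \in GLnodes n ->
  GLweight n z = (Ltilde R n).[1] ^- 2 * (GLquad n z / Num.sqrt (z * (1 - z))).
Proof.
move=> zs; have /andP[z0 z1] := GLnodes_itv zs.
have p0 : 0 < z * (1 - z) by rewrite mulr_gt0 ?subr_gt0.
have sq0 : Num.sqrt (z * (1 - z)) != 0 by rewrite gt_eqF // sqrtr_gt0.
have d0 : (Ltilde R n)^`().[z] != 0.
  by apply: (@simple_roots _ _ (GLnodes n)); rewrite ?uniq_GLnodes ?root_GLnodes.
have := Ltilde_at1_neq0 n.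
rewrite /GLweight GLquadE // (_ : 3 / 2 = 1 + 2^-1 :> R); last by field.
rewrite powRD ?(gt_eqF p0) ?implybT // powRr1 ?(ltW p0) // powR12_sqrt ?(ltW p0) //.
move: d0 sq0; move: (Num.sqrt _) (_^`().[z]) (_.[1]) => s d e d0 s0 e0.
field.
by rewrite s0 e0 d0 (gt_eqF z0) subr_eq0 (gt_eqF z1).
Qed.

(** The quadrature sum of 1/sqrt(p(1-p)), which is the total weight up to the factor L(1)^2. *)
Definition GLnorm n := \sum_(z <- GLnodes n) GLquad n z / Num.sqrt (z * (1 - z)).

Lemma fLX_deriv l x (z : R) : (0 < z < 1) -> (x <= l)%N ->
  fLX l x z = Num.sqrt (z * (1 - z)) * ('X ^+ x * (1 - 'X) ^+ (l - x))^`().[z].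
Proof.
move=> /andP[z0 z1] xl; rewrite /fLX /sigma.
have z1' : 0 < 1 - z by rewrite subr_gt0.
rewrite (_ : 1 - (1 - z) = z); last by ring.
rewrite sqrtrM ?(ltW z1') // sqrtrM ?(ltW z0) // sqrtrM ?(ltW z0) //.
rewrite !sqrtrV ?(ltW z0) ?(ltW z1') //.
have := sqr_sqrtr (ltW z0); have := sqr_sqrtr (ltW z1').
have : Num.sqrt z != 0 by rewrite gt_eqF // sqrtr_gt0.
have : Num.sqrt (1 - z) != 0 by rewrite gt_eqF // sqrtr_gt0.
rewrite derivM !deriv_exp derivB derivX deriv1 sub0r !(hornerMn, hornerE) /=.
move: (Num.sqrt z) (Num.sqrt (1 - z)) => a b b0 a0 b2 a2.
(* The leading factor m makes the identity hold at m = 0 as well, where [m.-1] is truncated. *)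
have e (m : nat) (y : R) : m%:R * y ^+ m = y * (y ^+ m.-1 *+ m).
  by case: m => [|m]; rewrite ?mul0r ?mulr0n ?mulr0 //= exprS -mulr_natl; ring.
have -> : z ^+ x * (1 - z) ^+ (l - x) * (x%:R * b / a - (l - x)%:R * a / b) =
  (x%:R * z ^+ x) * (1 - z) ^+ (l - x) * (b / a) -
  z ^+ x * ((l - x)%:R * (1 - z) ^+ (l - x)) * (a / b) by ring.
rewrite !e.
move: (z ^+ x.-1) ((1 - z) ^+ (l-x).-1) (z ^+ x) ((1 - z) ^+ (l - x)) => u v U V.
rewrite -b2 -a2; field.
by rewrite a0 b0.
Qed.

(** The square root in g cancels the one in the weight, leaving the quadrature of G', which is exact
    since deg G' < 2n. *)
Lemma GLexp_deriv n (g : R -> R) (G : {poly R}) : (size G <= n.*2.+1)%N ->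
  (forall z, 0 < z < 1 -> g z = Num.sqrt (z * (1 - z)) * G^`().[z]) ->
  GLexp n g = (G.[1] - G.[0]) / GLnorm n.
Proof.
move=> sG gE; rewrite /GLexp GLsuppE -!fsbig_seq ?uniq_GLnodes //=.
have K0 : (Ltilde R n).[1] ^- 2 != 0 by rewrite invr_neq0 // expf_neq0 ?Ltilde_at1_neq0.
have -> : \sum_(p <- GLnodes n) GLweight n p = (Ltilde R n).[1] ^- 2 * GLnorm n.
  by rewrite mulr_sumr; apply: eq_big_seq => z zs; rewrite GLweightE.
have -> : \sum_(p <- GLnodes n) GLweight n p * g p = (Ltilde R n).[1] ^- 2 * (G.[1] - G.[0]).
  rewrite -pint_deriv -(@GLquad_exact n).
    rewrite mulr_sumr; apply: eq_big_seq => z zs; have zI := GLnodes_itv zs.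
    rewrite GLweightE // gE //.
    have sq0 : Num.sqrt (z * (1 - z)) != 0.
      by rewrite gt_eqF // sqrtr_gt0 mulr_gt0 ?subr_gt0; case/andP: zI.
    by rewrite !mulrA; congr (_ * _); rewrite divfK.
  have [->|G0] := eqVneq G 0; first by rewrite deriv0 size_poly0.
  by rewrite -ltnS (leq_trans (lt_size_deriv G0)).
by rewrite -mulf_div divff // mul1r.
Qed.

(** For 0 < x < l the polynomial X^x (1 - X)^(l - x) vanishes at 0 and 1, so every such expectation
    is 0; at x = 0 it drops from 1 to 0. *)
Lemma calRlE n l : (0 < l <= n.*2)%N -> calRl R n l = (GLnorm n)^-1.
Proof.
move=> /andP[l0 ln].
have E x : (x <= l)%N -> GLexp n (fLX l x) =
    ((('X ^+ x * (1 - 'X) ^+ (l - x)) : {poly R}).[1] -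
     ('X ^+ x * (1 - 'X) ^+ (l - x)).[0]) / GLnorm n.
  move=> xl; apply: GLexp_deriv => // [|z zI]; last by rewrite fLX_deriv.
  rewrite (leq_trans (size_polyMleq _ _)) // size_polyXn /=.
  have := size_poly_exp_leq (1 - 'X : {poly R}) (l - x).
  have -> : 1 - 'X = - ('X - 1%:P) :> {poly R} by rewrite opprB.
  rewrite size_polyN size_XsubC /= mul1n.
  by move: (size _) => k; lia.
rewrite /calRl big_nat big1 ?subr0 => [|x /andP[x0 xl]]; last first.
  rewrite /RLX E ?(ltnW xl) // !hornerE subrr !expr0n.
  by rewrite subn_eq0 leqNgt xl eqn0Ngt x0 /= mulr0 mul0r subrr mul0r maxxx mulr0.
have -> : GLexp n (fun p : R => - fLX l 0 p) = - GLexp n (fLX l 0).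
  rewrite /GLexp GLsuppE -!fsbig_seq ?uniq_GLnodes //= -mulNr -sumrN.
  by congr (_ / _); apply: eq_bigr => z _; rewrite mulrN.
rewrite E // subn0 !hornerE subrr subr0 expr1n expr0n eqn0Ngt l0 /=.
by rewrite sub0r mulNr opprK mul1r.
Qed.

Lemma calRminE n : (0 < n)%N -> calRmin n = (GLnorm n)^-1.
Proof.
move=> n0; rewrite /calRmin calRlE; last by rewrite double_gt0.
rewrite big_nat; elim/big_rec: _ => // l x ll ->.
by rewrite calRlE ?minxx // -ltnS.
Qed.

End GaussLegendre.

(** * Monotonicity from the sign of the derivative *)

Section Monotone.
Variable R : realType.

Lemma derive_ge0_le (f df : R -> R) (a b : R) : a <= b ->
  (forall x, a <= x <= b -> is_derive x 1 f (df x)) ->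
  (forall x, a < x < b -> 0 <= df x) -> f a <= f b.
Proof.
rewrite le_eqVlt => /orP[/eqP -> //|ab] fd df0.
have fd' x : x \in `]a, b[ -> is_derive x 1 f (df x).
  by rewrite in_itv /= => /andP[/ltW ax /ltW xb]; apply: fd; rewrite ax.
have [|c cI e] := MVT ab fd'.
  apply: derivable_within_continuous => x; rewrite in_itv /= => xI.
  by have [] := fd x xI.
by rewrite -subr_ge0 e mulr_ge0 ?subr_ge0 ?(ltW ab) ?df0 //; rewrite in_itv in cI.
Qed.

Lemma derive_lt0_lt (f df : R -> R) (a b : R) : a < b ->
  (forall x, a <= x <= b -> is_derive x 1 f (df x)) ->
  (forall x, a < x < b -> df x < 0) -> f b < f a.
Proof.
move=> ab fd df0.
have fd' x : x \in `]a, b[ -> is_derive x 1 f (df x).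
  by rewrite in_itv /= => /andP[/ltW ax /ltW xb]; apply: fd; rewrite ax.
have [|c cI e] := MVT ab fd'.
  apply: derivable_within_continuous => x; rewrite in_itv /= => xI.
  by have [] := fd x xI.
by rewrite -subr_lt0 e nmulr_rlt0 ?subr_gt0 // df0 //; rewrite in_itv in cI.
Qed.

End Monotone.

(** * The arcsine series *)

Section Arcsine.
Variable R : realType.

(* binom(2k, k) / 4^k, the Taylor coefficients of (1 - v)^(-1/2) *)
Definition arccoef (k : nat) : R := \prod_(j < k) (j.*2.+1%:R / j.*2.+2%:R).

Lemma arccoefS k : arccoef k.+1 * k.*2.+2%:R = arccoef k * k.*2.+1%:R.
Proof. by rewrite /arccoef big_ord_recr /= -mulrA divfK ?pnatr_eq0. Qed.

Lemma arccoef_itv k : 0 <= arccoef k <= 1.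
Proof.
elim: k => [|k /andP[k0 k1]]; first by rewrite /arccoef big_ord0 ler01 lexx.
have -> : arccoef k.+1 = arccoef k * (k.*2.+1%:R / k.*2.+2%:R).
  by rewrite /arccoef big_ord_recr.
rewrite mulr_ge0 ?divr_ge0 //= mulr_ile1 ?divr_ge0 //.
by rewrite ler_pdivrMr ?ltr0n // mul1r ler_nat.
Qed.

Definition arcpoly N : {poly R} := \sum_(k < N.+1) arccoef k *: 'X^k.

(** The truncated Taylor series of arcsin. *)
Definition arcprim N : {poly R} :=
  \sum_(k < N.+1) (arccoef k / k.*2.+1%:R) *: 'X^(k.*2.+1).

Lemma arcpoly_nonneg N : nonneg_coefs (arcpoly N).
Proof.
move=> i; rewrite coef_sum sumr_ge0 // => k _; rewrite coefZ coefXn.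
by rewrite mulr_ge0 ?ler0n //; case/andP: (arccoef_itv k).
Qed.

Lemma size_arcpoly N : (size (arcpoly N) <= N.+1)%N.
Proof.
rewrite (leq_trans (size_sum _ _ _)) //; apply/bigmax_leqP => k _.
by rewrite (leq_trans (size_scale_leq _ _)) // size_polyXn.
Qed.

Lemma arcpoly_at0 N : (arcpoly N).[0] = 1.
Proof.
rewrite horner_sum big_ord_recl big1 => [|i _].
  by rewrite hornerZ hornerXn expr0 /arccoef big_ord0 mulr1 addr0.
by rewrite hornerZ hornerXn expr0n mulr0.
Qed.

(* The truncated series solves the equation 2 (1 - v) y' = y of (1 - v)^(-1/2)
   up to one monomial. *)
Lemma arcpoly_ode N : (1 - 'X) * (arcpoly N)^`() *+ 2 - arcpoly N =
  - (arccoef N * N.*2.+1%:R) *: 'X^N.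
Proof.
elim: N => [|N IH].
  rewrite /arcpoly big_ord1 expr0 derivZ deriv1 scaler0 mulr0 mul0rn sub0r.
  by rewrite mulr1 scaleNr.
have -> : arcpoly N.+1 = arcpoly N + arccoef N.+1 *: 'X^(N.+1).
  by rewrite /arcpoly big_ord_recr.
rewrite derivD derivZ derivXn /= mulrDr mulrnDl opprD addrACA IH -arccoefS.
rewrite (_ : 'X^N *+ N.+1 = N.+1%:R *: 'X^N :> {poly R}); last by rewrite scaler_nat.
rewrite exprS -!mul_polyC.
have -> : (N.*2.+2%:R : R) = N.+1%:R * 2 by rewrite -natrM muln2.
have -> : (N.+1.*2.+1%:R : R) = N.+1%:R * 2 + 1 by rewrite -natrM muln2 natr1.
by rewrite !(polyCM, polyCN, polyCD) polyC1; ring.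
Qed.

Lemma deriv_arcprim N : (arcprim N)^`() = arcpoly N \Po 'X^2.
Proof.
rewrite /arcprim /arcpoly rmorph_sum linear_sum /=; apply: eq_bigr => k _.
rewrite derivZ comp_polyZ rmorphXn /= comp_polyX derivXn /=.
rewrite -exprM mul2n -[X in _ *: X](scaler_nat _ 'X^(k.*2)).
by rewrite scalerA divfK ?pnatr_eq0.
Qed.

Lemma arcprim_odd N : (arcprim N).[-1] = - (arcprim N).[1].
Proof.
rewrite !horner_sum -sumrN; apply: eq_bigr => k _.
by rewrite !hornerZ !hornerXn expr1n -signr_odd /= odd_double expr1 mulrN.
Qed.

Lemma arcprim_at0 N : (arcprim N).[0] = 0.
Proof. by rewrite horner_sum big1 // => k _; rewrite hornerZ hornerXn expr0n mulr0. Qed.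

(** The substitution u = 2p - 1 gives half the increment of [arcprim] over [-1,1], and this
    polynomial is odd. *)
Lemma pint_arcpoly N : pint (arcpoly N \Po ('X *+ 2 - 1) ^+ 2) = (arcprim N).[1].
Proof.
have -> : arcpoly N \Po ('X *+ 2 - 1) ^+ 2 =
    (2^-1 *: (arcprim N \Po ('X *+ 2 - 1)))^`().
  rewrite derivZ deriv_comp deriv_arcprim -comp_polyA rmorphXn /= comp_polyX.
  rewrite derivB derivMn derivX deriv1 subr0 mulr_natr -[X in _ *: X]scaler_nat scalerA.
  by rewrite mulVf ?pnatr_eq0 // scale1r.
rewrite pint_deriv !hornerZ !horner_comp !(hornerMn, hornerE) mul0rn sub0r arcprim_odd.
have -> : 1 *+ 2 - 1 = 1 :> R by rewrite mulr2n addrK.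
by field.
Qed.

Lemma is_derive_horner_sin (p : {poly R}) (t : R) :
  is_derive t 1 (fun u => p.[sin u]) (p^`().[sin t] * cos t).
Proof.
by apply: (@is_derive_eq _ _ _ _ _ _ _ _ (@is_derive1_comp _ (horner p) sin t _ _ _ _)).
Qed.

(** The derivative of t -> [arcprim] (sin t); at v = (sin t)^2 it compares the truncation with (1 -
    v)^(-1/2), so it is close to 1 for large N. *)
Definition arcsinF N (t : R) := (arcpoly N \Po 'X^2).[sin t] * cos t.

(** By [arcpoly_ode] everything cancels except the one monomial left by the truncation. *)
Lemma is_derive_arcsinF N (t : R) : is_derive t 1 (arcsinF N)
  (- (arccoef N * N.*2.+1%:R) * sin t ^+ N.*2.+1).
Proof.
have H1 := is_derive_horner_sin (arcpoly N \Po 'X^2) t.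
have H2 := is_derive_cos t.
apply: (@is_derive_eq _ _ _ _ _ _ _ _ (is_deriveM H1 H2)).
rewrite deriv_comp derivXn /= expr1.
have := congr1 (fun p : {poly R} => p.[sin t ^+ 2]) (arcpoly_ode N).
rewrite /= !(hornerMn, hornerE, horner_comp) /=.
have c2 := cos2Dsin2 t.
rewrite -exprM mul2n [sin t ^+ N.*2.+1]exprS /GRing.scale /=.
move: c2; move: (arcpoly N).[_] (arcpoly N)^`().[_] => y y'.
move: (sin t) (cos t) => s c c2 e.
have -> : - (arccoef N * N.*2.+1%:R) * (s * s ^+ N.*2) =
   s * (- (arccoef N * N.*2.+1%:R) * s ^+ N.*2) by ring.
rewrite -e -c2; ring.
Qed.

Lemma is_derive_arcprim N (t : R) : is_derive t 1 (fun u => (arcprim N).[sin u]) (arcsinF N t).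
Proof. by rewrite /arcsinF -deriv_arcprim; exact: is_derive_horner_sin. Qed.

Lemma arcsinF0 N : arcsinF N 0 = 1.
Proof. by rewrite /arcsinF sin0 cos0 mulr1 horner_comp hornerXn expr0n arcpoly_at0. Qed.

Lemma pihalf_pi_le (t : R) : 0 <= t <= pi / 2 -> 0 <= t <= pi.
Proof. by move=> /andP[-> h] /=; have := @pi_gt0 R; lra. Qed.

Lemma arcsinF_le1 N (t : R) : 0 <= t <= pi / 2 -> arcsinF N t <= 1.
Proof.
move=> /andP[t0 tpi]; rewrite -(arcsinF0 N) -lerN2.
have d x : 0 <= x <= t -> is_derive x 1 (fun u => - arcsinF N u)
    (- (- (arccoef N * N.*2.+1%:R) * sin x ^+ N.*2.+1)).
  move=> _; have H := is_derive_arcsinF N x; exact: is_deriveN.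
apply: (derive_ge0_le t0 d) => x /andP[x0 xt].
rewrite -mulNr opprK mulr_ge0 ?mulr_ge0 ?exprn_ge0 //.
  by case/andP: (arccoef_itv N).
by apply/sin_ge0_pi/pihalf_pi_le; rewrite ltW //= ltW // (lt_le_trans xt).
Qed.

Lemma cos_le_in (x t : R) : 0 <= x <= t -> t <= pi / 2 -> cos t <= cos x.
Proof.
move=> /andP[x0 xt] tp; have [->//|xt'] := eqVneq x t.
have p0 := @pi_gt0 R.
by rewrite ltW // ltr_cos ?in_itv /= ?lt_neqAle ?xt' //; lra.
Qed.

Lemma arcsinF_ge N (t : R) : 0 <= t < pi / 2 ->
  1 - sin t ^+ N.*2.+2 / cos t <= arcsinF N t.
Proof.
move=> /andP[t0 tpi]; have p0 := @pi_gt0 R.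
have ct0 : 0 < cos t by rewrite cos_gt0_pihalf // tpi andbT; lra.
rewrite lerBlDr.
(* The added term grows at rate (2N + 2) (sin u)^(2N + 1) cos u / cos t, which outweighs the
   decrease of [arcsinF] because [arccoef N] <= 1 and cos t <= cos u. *)
pose g u := arcsinF N u + (cos t)^-1 * ('X^(N.*2.+2) : {poly R}).[sin u].
suff : g 0 <= g t.
  by rewrite /g arcsinF0 sin0 !hornerXn expr0n /= mulr0 addr0 [_^-1 * _]mulrC.
pose dg u := - (arccoef N * N.*2.+1%:R) * sin u ^+ N.*2.+1 +
   (cos t)^-1 * (('X^(N.*2.+2) : {poly R})^`().[sin u] * cos u).
have d x : 0 <= x <= t -> is_derive x 1 g (dg x).
  move=> _; have H1 := is_derive_arcsinF N x.
  have H2 := is_derive_horner_sin 'X^(N.*2.+2) x.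
  exact: (is_deriveD H1 (is_deriveZ (cos t)^-1 H2)).
apply: (derive_ge0_le t0 d) => x /andP[x0 xt].
rewrite /dg derivXn hornerMn hornerXn /= mulNr addrC subr_ge0.
have sx : 0 <= sin x.
  by apply/sin_ge0_pi/pihalf_pi_le; rewrite ltW //= ltW // (lt_trans xt).
have sxn : 0 <= sin x ^+ N.*2.+1 by rewrite exprn_ge0.
have cc : 1 <= (cos t)^-1 * cos x.
  by rewrite mulrC ler_pdivlMr // mul1r cos_le_in ?ltW // (ltW xt).
have a1 : arccoef N * N.*2.+1%:R <= N.*2.+2%:R.
  have /andP[a0 a1] := arccoef_itv N.
  rewrite (le_trans (ler_wpM2r (ler0n _ _) a1)) // mul1r ler_nat //.
rewrite -[sin x ^+ _ *+ _]mulr_natr.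
have -> : (cos t)^-1 * (sin x ^+ N.*2.+1 * N.*2.+2%:R * cos x) =
  (N.*2.+2%:R * sin x ^+ N.*2.+1) * ((cos t)^-1 * cos x) by ring.
rewrite (le_trans (ler_wpM2r sxn a1)) //.
by rewrite ler_peMr // mulr_ge0.
Qed.

Lemma arcprim_le N : (arcprim N).[1] <= pi / 2.
Proof.
rewrite -subr_ge0.
pose g u : R := u - (arcprim N).[sin u].
have -> : pi / 2 - (arcprim N).[1] = g (pi / 2) by rewrite /g sin_pihalf.
have -> : 0 = g 0 by rewrite /g sin0 arcprim_at0 subr0.
have d x : 0 <= x <= pi / 2 -> is_derive x 1 g (1 - arcsinF N x).
  move=> _; have H := is_derive_arcprim N x; exact: (is_deriveB (is_derive_id x 1) H).
apply: (derive_ge0_le _ d); first by rewrite divr_ge0 ?pi_ge0.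
by move=> x /andP[/ltW x0 /ltW xp]; rewrite subr_ge0 arcsinF_le1 ?x0.
Qed.

(** In effect [arcsinF] is integrated over [0, pi/2]: [arcsinF_ge] bounds it on [0, t], with the
    worst error at t, and on [t, pi/2] it is non-negative. *)
Lemma arcprim_ge N (t : R) : 0 <= t < pi / 2 ->
  t * (1 - sin t ^+ N.*2.+2 / cos t) <= (arcprim N).[1].
Proof.
move=> /andP[t0 tpi]; have p0 := @pi_gt0 R.
set K := 1 - _.
apply: (@le_trans _ _ (arcprim N).[sin t]).
  rewrite -subr_ge0.
  pose g u : R := (arcprim N).[sin u] - K *: u.
  have -> : (arcprim N).[sin t] - t * K = g t by rewrite /g /GRing.scale /= mulrC.
  have -> : 0 = g 0 by rewrite /g sin0 arcprim_at0 scaler0 subr0.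
  have d x : 0 <= x <= t -> is_derive x 1 g (arcsinF N x - K *: 1).
    move=> _; have H := is_derive_arcprim N x.
    exact: (is_deriveB H (is_deriveZ K (is_derive_id x 1))).
  apply: (derive_ge0_le t0 d) => x /andP[/ltW x0 xt].
  rewrite [_ *: _]mulr1 subr_ge0 (le_trans _ (arcsinF_ge N _)) ?x0 ?(lt_trans xt) //.
  rewrite /K lerD2l lerN2.
  have cc : cos t <= cos x by rewrite cos_le_in ?x0 ?(ltW xt) ?(ltW tpi).
  have ct0 : 0 < cos t by rewrite cos_gt0_pihalf // tpi andbT; lra.
  have sx : 0 <= sin x.
    by apply/sin_ge0_pi/pihalf_pi_le; rewrite x0 ltW // (lt_trans xt).
  have sxt : sin x <= sin t.
    by rewrite ltW // ltr_sin ?in_itv //=; lra.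
  have cx0 : 0 < cos x by rewrite (lt_le_trans ct0).
  apply: ler_pM; rewrite ?exprn_ge0 ?invr_ge0 ?(ltW cx0) //.
    by rewrite lerXn2r // nnegrE // (le_trans sx).
  by rewrite lef_pV2 // posrE.
rewrite -sin_pihalf.
have d x : t <= x <= pi / 2 ->
  is_derive x 1 (fun u => (arcprim N).[sin u]) (arcsinF N x).
  by move=> _; exact: is_derive_arcprim.
apply: (derive_ge0_le (ltW tpi) d) => x /andP[tx xp].
rewrite /arcsinF horner_comp hornerXn mulr_ge0 //.
  by rewrite nonneg_coefs_horner ?sqr_ge0 //; exact: arcpoly_nonneg.
by rewrite cos_ge0_pihalf //; lra.
Qed.

Lemma cvg_expr_even (q : R) : 0 <= q < 1 -> (fun N => q ^+ N.*2.+2) @ \oo --> (0 : R).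
Proof.
move=> /andP[q0 q1].
have -> : (fun N => q ^+ N.*2.+2) = (fun N => (q ^+ 2) ^+ N * q ^+ 2).
  by apply/funext => N; rewrite -exprM mul2n -exprD addn2.
rewrite -(mul0r (q ^+ 2)); apply: cvgMr_tmp; apply: cvg_expr.
by rewrite ger0_norm ?sqr_ge0 // exprn_ilt1.
Qed.

Lemma cvg_arcprim : (fun N => (arcprim N).[1]) @ \oo --> (pi / 2 : R).
Proof.
apply/cvgrPdist_le => e e0; have p1 := @pihalf_ge1 R.
(* Stopping short of pi/2 by at most e/2 keeps sin t < 1, so the error term vanishes as N grows; the
   cap 1 <= pi/2 keeps t non-negative. *)
pose d := Num.min (e / 2) 1.
have d0 : 0 < d by rewrite lt_min divr_gt0 ?ltr01.
have de : d <= e / 2 by rewrite ge_min lexx.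
have d1 : d <= 1 by rewrite ge_min lexx orbT.
pose t : R := pi / 2 - d.
have tI : 0 <= t < pi / 2 by rewrite /t; lra.
have t0 : 0 <= t by case/andP: tI.
have ct0 : 0 < cos t by rewrite cos_gt0_pihalf //; lra.
have st0 : 0 <= sin t by apply/sin_ge0_pi/pihalf_pi_le; lra.
have st1 : sin t < 1.
  by rewrite -sin_pihalf ltr_sin ?in_itv //=; lra.
have : (fun N => t * (sin t ^+ N.*2.+2 / cos t)) @ \oo --> (0 : R).
  have -> : 0 = t * (0 / cos t) by rewrite mul0r mulr0.
  by apply: cvgMl_tmp; apply: cvgMr_tmp; apply: cvg_expr_even; rewrite st0.
move=> /cvgrPdist_le/(_ (e / 2)); rewrite divr_gt0 // => /(_ isT) H.
near=> N.
have : `|0 - t * (sin t ^+ N.*2.+2 / cos t)| <= e / 2 by near: N.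
rewrite sub0r normrN => /ler_normlP[_ h].
have := arcprim_ge N tI; have := arcprim_le N; rewrite mulrBr mulr1 => h1 h2.
by rewrite ger0_norm ?subr_ge0 //; rewrite /t in h2 h; lra.
Unshelve. all: by end_near. Qed.

(** The bounds on [arcsinF] read at t = arcsin (sqrt v), where cos t = sqrt (1 - v). *)
Lemma arcpoly_sqrt N (v : R) : 0 <= v < 1 ->
  1 - v ^+ N.+1 / Num.sqrt (1 - v) <= (arcpoly N).[v] * Num.sqrt (1 - v) <= 1.
Proof.
move=> /andP[v0 v1]; pose u := Num.sqrt v.
have u0 : 0 <= u by rewrite sqrtr_ge0.
have uv : u ^+ 2 = v by rewrite sqr_sqrtr.
have u1 : u < 1.
  by rewrite ltNge; apply/negP => /(@exprn_ege1 _ 2); rewrite uv; lra.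
have uI : -1 <= u <= 1 by lra.
have su : sin (asin u) = u by rewrite asinK ?in_itv.
have t1 : asin u < pi / 2 by rewrite asin_ltpi2 // u1 andbT; lra.
have p0 := @pihalf_ge1 R.
have t0 : 0 <= asin u.
  rewrite leNgt; apply/negP => h.
  have i1 : asin u \in `[(- (pi / 2)), pi / 2].
    by rewrite in_itv /= asin_geNpi2 ?asin_lepi2.
  have i2 : 0 \in `[(- (pi / 2)), pi / 2 : R] by rewrite in_itv /=; lra.
  by have := ltr_sin i1 i2; rewrite sin0 su h; lra.
have tI : 0 <= asin u < pi / 2 by rewrite t0.
have := arcsinF_ge N tI; have := @arcsinF_le1 N (asin u).
rewrite t0 ltW // /arcsinF horner_comp hornerXn su cos_asin // uv.
have -> : u ^+ N.*2.+2 = v ^+ N.+1 by rewrite -uv -exprM mul2n.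
by move=> /(_ isT) -> ->.
Qed.

Lemma arcpoly_le N (v : R) : 0 <= v < 1 -> (arcpoly N).[v] <= (Num.sqrt (1 - v))^-1.
Proof.
move=> vI; have /andP[_] := arcpoly_sqrt N vI.
have s0 : 0 < Num.sqrt (1 - v) by rewrite sqrtr_gt0; lra.
by rewrite -ler_pdivlMr // div1r.
Qed.

Lemma cvg_arcpoly (v : R) : 0 <= v < 1 ->
  (fun N => (arcpoly N).[v]) @ \oo --> (Num.sqrt (1 - v))^-1.
Proof.
move=> vI; set c := Num.sqrt (1 - v).
have c0 : 0 < c by rewrite sqrtr_gt0; lra.
apply: (@squeeze_cvgr _ _ _ _ (fun N => (1 - v ^+ N.+1 / c) / c) (fun=> c^-1)).
- near=> N; rewrite arcpoly_le // andbT.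
  by have /andP[h _] := arcpoly_sqrt N vI; rewrite ler_pdivrMr.
- suff : (fun N => (1 - v ^+ N.+1 / c) / c) @ \oo --> (1 - 0 / c) / c.
    by rewrite mul0r subr0 div1r.
  have h : (fun N => v ^+ N.+1) @ \oo --> (0 : R).
    rewrite (cvg_shiftS (fun N => v ^+ N)); apply: cvg_expr.
    by rewrite ger0_norm; lra.
  apply: cvgMr_tmp.
  have h2 : (fun N => v ^+ N.+1 / c) @ \oo --> 0 / c by apply: cvgMr_tmp h.
  have h1 : (fun N : nat => 1 : R) @ \oo --> (1 : R) by apply: cvg_cst.
  exact: (cvgB h1 h2).
- exact: cvg_cst.
Unshelve. all: by end_near. Qed.

End Arcsine.

(** * The normalising sum tends to pi *)

Section NormLimit.
Variable R : realType.

Lemma cvg_sum_seq (I : eqType) (s : seq I) (u : nat -> I -> R) (l : I -> R) :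
  (forall i, i \in s -> (fun n => u n i) @ \oo --> l i) ->
  (fun n => \sum_(i <- s) u n i) @ \oo --> \sum_(i <- s) l i.
Proof.
elim: s => [|i s IH] h.
  by under eq_fun do rewrite big_nil; rewrite big_nil; exact: cvg_cst.
under eq_fun do rewrite big_cons; rewrite big_cons.
apply: cvgD; first by apply: h; rewrite mem_head.
by apply: IH => j js; apply: h; rewrite in_cons js orbT.
Qed.

Lemma one_sub_U2 (z : R) : 1 - (z *+ 2 - 1) ^+ 2 = 4 * (z * (1 - z)).
Proof. by ring. Qed.

Lemma U2_itv (z : R) : 0 < z < 1 -> 0 <= (z *+ 2 - 1) ^+ 2 < 1.
Proof.
move=> /andP[z0 z1]; rewrite sqr_ge0 /= -subr_gt0 one_sub_U2.
by rewrite !mulr_gt0 ?subr_gt0.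
Qed.

Lemma sqrt_U2 (z : R) :
  (Num.sqrt (z * (1 - z)))^-1 = 2 * (Num.sqrt (1 - (z *+ 2 - 1) ^+ 2))^-1.
Proof.
rewrite one_sub_U2 (@sqrtrM _ 4) //.
have -> : Num.sqrt 4 = Num.sqrt (2 ^+ 2) :> R by rewrite -natrX.
by rewrite sqrtr_sqr ger0_norm // invfM mulrA divff ?pnatr_eq0 // mul1r.
Qed.

Lemma GLnormE n : GLnorm R n =
  2 * \sum_(z <- GLnodes R n) GLquad n z * (Num.sqrt (1 - (z *+ 2 - 1) ^+ 2))^-1.
Proof.
by rewrite mulr_sumr; apply: eq_bigr => z _; rewrite sqrt_U2 mulrCA.
Qed.

(** With n + 1 nodes the truncation of degree n in (2p - 1)^2 is integrated exactly, and it lies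
    below the function at every node. *)
Lemma GLnorm_ge n : 2 * (arcprim R n).[1] <= GLnorm R n.+1.
Proof.
rewrite GLnormE ler_pM2l // -pint_arcpoly -(@GLquad_exact _ n.+1); last first.
  by apply: (@size_U2_comp _ _ n.+1); exact: size_arcpoly.
rewrite big_seq [leRHS]big_seq; apply: ler_sum => z zs.
rewrite ler_wpM2l ?(ltW (GLquad_gt0 zs)) // horner_comp horner_U2 arcpoly_le //.
by apply/U2_itv/(GLnodes_itv zs).
Qed.

(** With the nodes fixed, every truncation has quadrature sum at most pi/2; N tends to infinity at
    each of the finitely many nodes. *)
Lemma GLnorm_le n : GLnorm R n <= pi.
Proof.
rewrite GLnormE mulrC -ler_pdivlMr //.
apply: (@cvgr_to_le nat \oo _ R (fun N => \sum_(z <- GLnodes R n)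
  GLquad n z * (arcpoly R N).[(z *+ 2 - 1) ^+ 2])); last first.
  near=> N; rewrite (le_trans (GLquad_upper n (arcpoly_nonneg R N))) //.
  by rewrite pint_arcpoly arcprim_le.
apply: cvg_sum_seq => z zs.
by apply: cvgMl_tmp; apply: cvg_arcpoly; apply/U2_itv/(GLnodes_itv zs).
Unshelve. all: by end_near. Qed.

Lemma cvg_GLnorm : (fun n => GLnorm R n.+1) @ \oo --> (pi : R).
Proof.
apply: (@squeeze_cvgr _ _ _ _ (fun n => 2 * (arcprim R n).[1]) (fun=> pi)).
- by near=> n; rewrite GLnorm_ge GLnorm_le.
- suff : (fun n => 2 * (arcprim R n).[1]) @ \oo --> 2 * (pi / 2 : R).
    by rewrite mulrC divfK ?pnatr_eq0.
  by apply: cvgMl_tmp; exact: cvg_arcprim.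
- exact: cvg_cst.
Unshelve. all: by end_near. Qed.

Lemma cvg_calRmin : (fun n => calRmin n.+1) @ \oo --> (pi^-1 : R).
Proof.
under eq_fun do rewrite calRminE //.
by apply: cvgV; [rewrite gt_eqF // pi_gt0|exact: cvg_GLnorm].
Qed.

End NormLimit.

(** * The Bessel function J0 *)

Section EntireSeries.
Variable R : realType.
Implicit Types (c : nat -> R) (x : R).

(** A growth condition that forces an infinite radius of convergence and is stable under formal
    differentiation. *)
Definition entire_coef c :=
  exists A K : R, 0 <= K /\ forall k, `|c k| <= A * (K ^+ k / k`!%:R).

Lemma entire_coef_ge0 c (A K : R) :
  (forall k, `|c k| <= A * (K ^+ k / k`!%:R)) -> 0 <= A.
Proof. by move=> /(_ 0%N); rewrite expr0 fact0 divr1 mulr1; exact: le_trans. Qed.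

Lemma is_cvg_entire c x : entire_coef c -> cvgn (pseries c x).
Proof.
move=> [A [K [K0 cK]]]; have A0 := entire_coef_ge0 cK; apply: normed_cvg.
apply: (@series_le_cvg _ _ (fun k => A * exp_coeff (K * `|x|) k)) => [k|k|k|].
- exact: normr_ge0.
- by rewrite mulr_ge0 // exp_coeff_ge0 // mulr_ge0.
- rewrite /= normrM normrX /exp_coeff /= exprMn.
  rewrite (le_trans (ler_wpM2r _ (cK k))) ?exprn_ge0 //.
  by rewrite le_eqVlt; apply/orP; left; apply/eqP; ring.
- by have := @is_cvg_seriesZ _ _ A (is_cvg_series_exp_coeff (K * `|x|)).
Qed.

Lemma entire_diffs c : entire_coef c -> entire_coef (pseries_diffs c).
Proof.
move=> [A [K [K0 cK]]]; have A0 := entire_coef_ge0 cK.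
exists (A * K), K; split => // k; rewrite /pseries_diffs normrM normr_nat.
rewrite (le_trans (ler_wpM2l _ (cK k.+1))) //.
rewrite le_eqVlt; apply/orP; left; apply/eqP.
rewrite factS natrM exprS; field.
by rewrite nat1r !pnatr_eq0 -lt0n fact_gt0.
Qed.

Lemma is_derive_entire c x : entire_coef c ->
  is_derive x 1 (fun y => limn (pseries c y)) (limn (pseries (pseries_diffs c) x)).
Proof.
move=> ec; apply: (@pseries_snd_diffs _ _ (`|x| + 1)).
- exact: is_cvg_entire.
- exact/is_cvg_entire/entire_diffs.
- exact/is_cvg_entire/entire_diffs/entire_diffs.
- by rewrite (ger0_norm (_ : 0 <= `|x| + 1)) ?ltrDl // addr_ge0.
Qed.

Lemma continuous_is_derive (f : R -> R) x df : is_derive x 1 f df -> {for x, continuous f}.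
Proof. by move=> [h _]; apply/differentiable_continuous/derivable1_diffP. Qed.

(** The zero is the infimum of the points x >= 0 with f x <= 0; continuity there excludes both
    strict signs. *)
Lemma first_zero (f : R -> R) (b : R) : 0 <= b -> continuous f -> 0 < f 0 -> f b < 0 ->
  exists c : R, [/\ 0 < c, f c = 0 & forall s, 0 <= s < c -> 0 < f s].
Proof.
move=> b0 fc f0 fb; pose E := [set x : R | 0 <= x /\ f x <= 0].
have Eb : E b by split => //; exact: ltW.
have Elb : lbound E 0 by move=> x [].
have hinf : has_inf E by split; [exists b|exists 0].
pose c := inf E.
have c0 : 0 <= c by apply: lb_le_inf => //; exists b.
have pos s : 0 <= s < c -> 0 < f s.
  move=> /andP[s0 sc]; rewrite ltNge; apply/negP => fs.
  have : c <= s by apply: ge_inf; [exists 0|split].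
  by rewrite leNgt sc.
have fcle : f c <= 0.
  rewrite leNgt; apply/negP => fc0.
  have /nbhs_ballP[e /= e0 he] : \forall y \near c, 0 < f y by exact: (cvgr_gt _ (fc c)).
  have [x [x0 fx] xe] := inf_adherent e0 hinf.
  have cx : c <= x by apply: ge_inf; [exists 0|split].
  have : 0 < f x.
    by apply: he; rewrite /ball /= ler0_norm ?subr_le0 // opprB ltrBlDl.
  by rewrite ltNge fx.
have cpos : 0 < c.
  rewrite lt_neqAle c0 andbT; apply/negP => /eqP e.
  by move: fcle; rewrite -e leNgt f0.
exists c; split => //; apply/eqP; rewrite eq_le fcle /= leNgt; apply/negP => fc0.
have /nbhs_ballP[e /= e0 he] : \forall y \near c, f y < 0 by exact: (cvgr_lt _ (fc c)).
pose d := Num.min (e / 2) c.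
have d0 : 0 < d by rewrite lt_min divr_gt0.
have de : d <= e / 2 by rewrite ge_min lexx.
have dc : d <= c by rewrite ge_min lexx orbT.
have : 0 < f (c - d) by apply: pos; lra.
rewrite ltNge ltW //; apply: he; rewrite /ball /= ger0_norm; lra.
Qed.

End EntireSeries.

(** * The first zero of J0 and its simplicity *)

Section Bessel.
Variable R : realType.
Implicit Types (z : R).

Definition bess k : R := (-1) ^+ k / k`!%:R ^+ 2.
Definition dbess k : R := k%:R * bess k.

(* [besselB z] is J0 at 2 sqrt z, and [besselD z] is z times its derivative. *)
Definition besselB z := limn (pseries bess z).
Definition besselD z := limn (pseries dbess z).

Let fact_neq0 k : k`!%:R != 0 :> R.
Proof. by rewrite pnatr_eq0 -lt0n fact_gt0. Qed.

Lemma norm_bess k : `|bess k| = (k`!%:R ^+ 2)^-1.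
Proof. by rewrite normrM normrX normrN1 expr1n mul1r ger0_norm ?invr_ge0 ?sqr_ge0. Qed.

Lemma bess_le k : `|bess k| <= (k`!%:R)^-1.
Proof.
rewrite norm_bess lef_pV2 ?posrE ?exprn_gt0 ?ltr0n ?fact_gt0 //.
by rewrite expr2 ler_peMr // ler1n fact_gt0.
Qed.

Lemma entire_bess : entire_coef bess.
Proof. by exists 1, 1; split => // k; rewrite expr1n !mul1r bess_le. Qed.

Lemma entire_dbess : entire_coef dbess.
Proof.
exists 1, 1; split => // k; rewrite expr1n !mul1r /dbess normrM norm_bess normr_nat.
rewrite expr2 invfM mulrA ler_piMl ?invr_ge0 //.
rewrite ler_pdivrMr ?ltr0n ?fact_gt0 // mul1r ler_nat.
by case: k => // k; rewrite factS leq_pmulr // fact_gt0.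
Qed.

Lemma besselB0 : besselB 0 = 1.
Proof.
apply: cvg_lim => //; rewrite -cvg_shiftS.
suff -> : (fun n => pseries bess 0 n.+1) = (fun=> 1) by exact: cvg_cst.
apply/funext => n; rewrite /pseries /series /= big_nat_recl //= big1 => [|i _].
  by rewrite /bess !expr0 fact0 expr1n divr1 mulr1 addr0.
by rewrite exprS mul0r mulr0.
Qed.

Lemma besselDE z : besselD z = z * limn (pseries (pseries_diffs bess) z).
Proof.
have h := pseries_diffs_equiv (@is_cvg_entire _ _ z (entire_diffs entire_bess)).
apply: cvg_lim => //.
have -> : pseries dbess z =
    (fun n => z * series (fun i => i%:R * bess i * z ^+ i.-1) n).
  apply/funext => n; rewrite /pseries /series /= mulr_sumr.
  apply: eq_bigr => -[|i] _; first by rewrite /dbess !(mul0r, mulr0).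
  by rewrite /dbess /= exprS; ring.
exact: cvgMl_tmp.
Qed.

Lemma is_derive_besselB z : is_derive z 1 besselB (limn (pseries (pseries_diffs bess) z)).
Proof. exact: is_derive_entire entire_bess. Qed.

(** Bessel's equation (z B')' = - B, read off from the coefficients: (k + 1)^2 [bess] (k + 1) = -
    [bess] k. *)
Lemma is_derive_besselD z : is_derive z 1 besselD (- besselB z).
Proof.
apply: (@is_derive_eq _ _ _ _ _ _ _ _ (@is_derive_entire _ _ z entire_dbess)).
rewrite /besselB -limN; last exact: (@is_cvg_entire _ _ z entire_bess).
congr (limn _); apply/funext => n; rewrite /pseries /series /= fctE -sumrN.
apply: eq_bigr => i _; rewrite /pseries_diffs /dbess /bess factS natrM exprS.
field.
by rewrite fact_neq0 nat1r pnatr_eq0.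
Qed.

Lemma continuous_besselB : continuous besselB.
Proof. by move=> z; exact: continuous_is_derive (is_derive_besselB z). Qed.

Lemma continuous_besselD : continuous besselD.
Proof. by move=> z; exact: continuous_is_derive (is_derive_besselD z). Qed.

(** Five terms of the alternating series sum to -7/36, and each later pair of terms is non-positive.
    This sign change guarantees that a first zero exists. *)
Lemma besselB2_lt0 : besselB 2 < 0.
Proof.
pose S n := pseries bess (2 : R) n.
have S5 : S 5%N = - (7 / 36).
  rewrite /S /pseries /series /= !big_nat_recr //= big_nil /bess /=.
  by rewrite !factS fact0 /=; field.
have step n : S (n.*2 + 5)%N <= S 5%N.
  elim: n => // n IH; apply: le_trans IH.
  have -> : (n.+1.*2 + 5 = (n.*2 + 5).+2)%N by lia.
  set m := (n.*2 + 5)%N.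
  have mo : odd m by rewrite oddD odd_double.
  rewrite /S /pseries /series /= !big_nat_recr //= -addrA gerDl.
  rewrite /bess [(-1) ^+ m.+1]exprS -signr_odd mo expr1 factS natrM [2 ^+ m.+1]exprS.
  set f := (m`!%:R : R); have f0 : 0 < f by rewrite ltr0n fact_gt0.
  have -> : -1 / f ^+ 2 * 2 ^+ m + -1 * -1 / (m.+1%:R * f) ^+ 2 * (2 * 2 ^+ m) =
     (2 ^+ m / f ^+ 2) * (2 / m.+1%:R ^+ 2 - 1).
    by field; rewrite (gt_eqF f0) nat1r pnatr_eq0.
  rewrite mulr_ge0_le0 ?divr_ge0 ?exprn_ge0 ?ltW //.
  rewrite subr_lt0 ltr_pdivrMr ?exprn_gt0 ?ltr0n // mul1r -natrX ltr_nat.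
  by rewrite /m; nia.
apply: (@le_lt_trans _ _ (- (7 / 36))); last by lra.
rewrite leNgt; apply/negP => h.
have cS : S @ \oo --> besselB 2 by exact: (@is_cvg_entire _ _ 2 entire_bess).
have [N _ HN] := cvgr_gt _ cS _ h.
have NN : (N <= N.*2 + 5)%N by lia.
by have := HN _ NN; rewrite /= ltNge -S5 step.
Qed.

Lemma J0E (t : R) : J0 t = besselB ((t / 2) ^+ 2).
Proof.
rewrite /J0 /besselB; congr (limn (series _)); apply/funext => i.
by rewrite /bess exprM mulrAC.
Qed.

(** The map t -> (t/2)^2 is increasing on t > 0, so it carries the first positive zero of J0 to that
    of B; as the latter exists, [j1] is not the default of [xget]. *)
Lemma j1_spec : [/\ 0 < j1 :> R, besselB ((j1 / 2) ^+ 2) = 0 &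
  forall z, 0 <= z < (j1 / 2) ^+ 2 -> 0 < besselB z].
Proof.
have [c [c0 Bc Bpos]] := @first_zero R besselB 2 (ler0n _ _) continuous_besselB
  (eq_ind_r (fun x => 0 < x) ltr01 besselB0) besselB2_lt0.
pose t : R := 2 * Num.sqrt c.
have s0 : 0 < Num.sqrt c by rewrite sqrtr_gt0.
have t0 : 0 < t by rewrite mulr_gt0.
have tc : (t / 2) ^+ 2 = c by rewrite /t mulrC mulKf ?pnatr_eq0 // sqr_sqrtr // ltW.
have small s : 0 < s < t -> 0 <= (s / 2) ^+ 2 < c.
  by move=> /andP[s1 s2]; rewrite -tc sqr_ge0 ltrXn2r ?nnegrE //=; lra.
have Jt : J0 t = 0 by rewrite J0E tc.
suff -> : j1 = t by rewrite tc.
rewrite /j1; case: xgetP => [x _ [x0 [Jx xmin]]|/(_ t)]; last first.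
  by case; split => //; split => // s /small /Bpos; rewrite J0E => /lt0r_neq0.
apply/eqP; rewrite eq_le !leNgt; apply/andP; split; apply/negP => h.
  by have := xmin t; rewrite t0 h Jt eqxx => /(_ isT).
by have := Bpos ((x / 2) ^+ 2); rewrite -J0E Jx ltxx small ?x0 // => /(_ isT).
Qed.

Definition bessel_zero : R := (j1 / 2) ^+ 2.

Local Notation z1 := bessel_zero.

Lemma bessel_zero_gt0 : 0 < z1.
Proof. by have [j0 _ _] := j1_spec; rewrite /bessel_zero exprn_gt0 // divr_gt0. Qed.

Lemma besselD_lt0 z : 0 < z <= z1 -> besselD z < 0.
Proof.
move=> /andP[z0 zz1]; have D0 : besselD 0 = 0 by rewrite besselDE mul0r.
rewrite -D0; have [_ _ Bpos] := j1_spec.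
apply: (@derive_lt0_lt _ besselD (fun x => - besselB x)) => // x.
  by move=> _; exact: is_derive_besselD.
move=> /andP[x0 xz]; rewrite oppr_lt0; apply: Bpos.
by rewrite ltW //= (lt_le_trans xz).
Qed.

(** For z > 0 the sign of B' is that of D = z B'. *)
Lemma besselB_decr (a b : R) : 0 <= a -> a < b ->
  (forall x, a < x < b -> besselD x < 0) -> besselB b < besselB a.
Proof.
move=> a0 ab Dneg.
apply: (@derive_lt0_lt _ besselB (fun x => limn (pseries (pseries_diffs bess) x))) => // x.
  by move=> _; exact: is_derive_besselB.
move=> xI; have x0 : 0 < x by case/andP: xI => ax _; exact: le_lt_trans ax.
by have := Dneg x xI; rewrite besselDE pmulr_rlt0.
Qed.

Lemma besselB_le (a b : R) : 0 <= a <= b -> b <= z1 -> besselB b <= besselB a.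
Proof.
move=> /andP[a0]; rewrite le_eqVlt => /orP[/eqP -> //|ab] bz.
rewrite ltW // besselB_decr // => x /andP[ax xb]; apply: besselD_lt0.
by rewrite (le_lt_trans a0 ax) ltW // (lt_le_trans xb).
Qed.

(* The first zero is simple: D < 0 there, since D' = - B < 0 on the left. *)
Lemma besselB_neg (e : R) : 0 < e -> exists2 z, z1 < z < z1 + e & besselB z < 0.
Proof.
move=> e0; have Dz1 : besselD z1 < 0 by rewrite besselD_lt0 // bessel_zero_gt0 lexx.
have /nbhs_ballP[d /= d0 hd] : \forall y \near z1, besselD y < 0.
  have cD : besselD y @[y --> z1] --> besselD z1 by exact: continuous_besselD.
  exact: (cvgr_lt _ cD).
pose m := Num.min (e / 2) (d / 2).
have m0 : 0 < m by rewrite lt_min !divr_gt0.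
have me : m <= e / 2 by rewrite ge_min lexx.
have md : m <= d / 2 by rewrite ge_min lexx orbT.
exists (z1 + m); first by lra.
have [_ B0 _] := j1_spec; rewrite -B0 -/z1.
have := bessel_zero_gt0 => z10.
apply: besselB_decr; [lra|lra|] => x xI; apply: hd.
by rewrite /ball /= ler0_norm; lra.
Qed.

End Bessel.

(** * Mehler-Heine asymptotics of the smallest node *)

Section MehlerHeine.
Variable R : realType.
Implicit Types (z : R).

Local Notation NN n := (n%:R * n.+1%:R : R).

(* With N = n (n + 1), the coefficient of p^k in Ltilde, divided by the constant
   one, is [mhcoef n k] times the coefficient of p^k in J0 (2 sqrt (N p)). *)
Definition mhcoef n k : R := \prod_(j < k) (1 - j%:R * j.+1%:R / NN n).

Lemma mhcoefS n k : mhcoef n k.+1 = mhcoef n k * (1 - k%:R * k.+1%:R / NN n).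
Proof. by rewrite /mhcoef big_ord_recr. Qed.

(** The factors with j < n lie in [0,1], and the factor j = n is 0, which annihilates all longer
    products. *)
Lemma mhcoef_itv n k : (0 < n)%N ->
  0 <= mhcoef n k <= 1 /\ ((n < k)%N -> mhcoef n k = 0).
Proof.
move=> n0; have N0 : 0 < NN n by rewrite mulr_gt0 ?ltr0n.
elim: k => [|k [/andP[c0 c1] cz]]; first by rewrite /mhcoef big_ord0 ler01 lexx.
rewrite mhcoefS.
have [nk|kn] := ltnP n k; first by rewrite cz // mul0r lexx ler01.
have r1 : k%:R * k.+1%:R / NN n <= 1.
  by rewrite ler_pdivrMr // mul1r -!natrM ler_nat leq_mul.
have r0 : 0 <= k%:R * k.+1%:R / NN n by rewrite divr_ge0 ?mulr_ge0.
split; first by rewrite mulr_ge0 ?subr_ge0 //= mulr_ile1 ?subr_ge0 ?gerBl.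
rewrite ltnS => nk; have -> : k = n by apply/eqP; rewrite eqn_leq kn.
by rewrite divff ?gt_eqF // subrr mulr0.
Qed.

(** Each step loses at most k (k + 1) / N, and these losses add up to at most k^3 / N. *)
Lemma mhcoef_ge n k : (0 < n)%N -> 1 - k%:R ^+ 3 / NN n <= mhcoef n k.
Proof.
move=> n0; have N0 : 0 < NN n by rewrite mulr_gt0 ?ltr0n.
elim: k => [|k IH]; first by rewrite /mhcoef big_ord0 expr0n mul0r subr0.
have [/andP[c0 c1] _] := @mhcoef_itv n k n0; rewrite mhcoefS.
have i0 : 0 <= (NN n)^-1 by rewrite invr_ge0 ltW.
have k0 : 0 <= k%:R :> R by rewrite ler0n.
have kS : k.+1%:R = k%:R + 1 :> R by rewrite natr1.
have h1 : mhcoef n k * (k%:R * k.+1%:R / NN n) <= k%:R * k.+1%:R / NN n.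
  by rewrite ler_piMl // divr_ge0 ?mulr_ge0 // ltW.
rewrite mulrBr mulr1.
have h2 : (k%:R ^+ 3 + k%:R * k.+1%:R) / NN n <= k.+1%:R ^+ 3 / NN n.
  by rewrite ler_wpM2r // kS; nra.
rewrite mulrDl in h2; move: IH h1 h2.
move: (k%:R ^+ 3 / _) (k%:R * _ / _) (k.+1%:R ^+ 3 / _) => a b d IH h1 h2; lra.
Qed.

(** The ratio of consecutive coefficients rests on (n - k)(n + k + 1) = n (n + 1) - k (k + 1). *)
Lemma legcoef_rec n k : ('C(n, k.+1) * (n + k.+1) ^_ n)%:R * k.+1%:R ^+ 2 =
  ('C(n, k) * (n + k) ^_ n)%:R * (NN n - k%:R * k.+1%:R) :> R.
Proof.
have e1 := mul_bin_left n k.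
have e2 : ((n + k.+1) ^_ n * k.+1 = (n + k) ^_ n * (n + k.+1))%N.
  have f1 := @ffact_fact (n + k.+1) n (leq_addr _ _).
  have f2 := @ffact_fact (n + k) n (leq_addr _ _).
  rewrite addKn in f1; rewrite addKn in f2.
  apply/eqP; rewrite -(eqn_pmul2r (fact_gt0 k)) -mulnA -factS f1.
  by rewrite addnS factS -f2 mulnC -mulnA [(k`! * _)%N]mulnC mulnA.
have -> : ('C(n, k.+1) * (n + k.+1) ^_ n)%:R * k.+1%:R ^+ 2 =
  ((k.+1 * 'C(n, k.+1)) * ((n + k.+1) ^_ n * k.+1))%:R :> R.
  by rewrite !natrM; ring.
rewrite e1 e2.
have [kn|nk] := leqP k n; last by rewrite bin_small // muln0 !mul0n mul0r.
rewrite !natrM natrB // natrD -[k.+1%:R]natr1 -[n.+1%:R]natr1; ring.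
Qed.

Lemma legcoefE n k : (0 < n)%N -> ('C(n, k) * (n + k) ^_ n)%:R =
  n`!%:R * (k`!%:R ^+ 2)^-1 * mhcoef n k * NN n ^+ k :> R.
Proof.
move=> n0; have N0 : NN n != 0 by rewrite mulf_neq0 ?pnatr_eq0 -?lt0n.
elim: k => [|k IH].
  by rewrite bin0 addn0 ffactnn mul1n fact0 expr1n invr1 /mhcoef big_ord0 expr0 !mulr1.
have k0 : k.+1%:R != 0 :> R by rewrite pnatr_eq0.
have f0 : k`!%:R != 0 :> R by rewrite pnatr_eq0 -lt0n fact_gt0.
apply: (mulIf (expf_neq0 2 k0)); rewrite legcoef_rec IH mhcoefS factS natrM.
rewrite [NN n ^+ k.+1]exprS.
have -> : NN n - k%:R * k.+1%:R = NN n * (1 - k%:R * k.+1%:R / NN n).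
  by rewrite mulrBr mulr1 mulrCA divff ?mulr1.
move: (1 - _) => A; move: (mhcoef n k) (NN n ^+ k) => B C.
by field; rewrite f0 nat1r.
Qed.

Lemma Ltilde_at0 n : (Ltilde R n).[0] = 2 ^+ n * ((-1) ^+ n * n`!%:R).
Proof. by rewrite horner_coef0 coef_Ltilde addn0 bin0 mul1n ffactnn. Qed.

Lemma Ltilde_at0_neq0 n : (Ltilde R n).[0] != 0.
Proof.
by rewrite Ltilde_at0 !mulf_neq0 ?expf_neq0 ?signr_eq0 ?pnatr_eq0 // -lt0n fact_gt0.
Qed.

Lemma coef_LtildeE n k : (0 < n)%N ->
  (Ltilde R n)`_k = (Ltilde R n).[0] * (bess R k * mhcoef n k * NN n ^+ k).
Proof.
by move=> n0; rewrite coef_Ltilde legcoefE // Ltilde_at0 /bess exprD; ring.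
Qed.

Definition Phi n z : R := (Ltilde R n).[z / NN n] / (Ltilde R n).[0].

(** Any length m > n is allowed, so that the sum can be matched term by term with a long partial sum
    of the Bessel series. *)
Lemma PhiE n z m : (0 < n)%N -> (n < m)%N ->
  Phi n z = \sum_(0 <= k < m) bess R k * mhcoef n k * z ^+ k.
Proof.
move=> n0 nm; have N0 : NN n != 0 by rewrite mulf_neq0 ?pnatr_eq0 -?lt0n.
rewrite /Phi (@horner_coef_wide _ m) ?size_Ltilde // mulr_suml big_mkord.
apply: eq_bigr => k _; rewrite coef_LtildeE // expr_div_n.
have := expf_neq0 k N0; have := Ltilde_at0_neq0 n.
move: (_.[0]) (NN n ^+ k) => A B A0 B0.
by field; rewrite A0 B0.
Qed.

Lemma series_exp_le (x : R) m : 0 <= x -> series (exp_coeff x) m <= expR x.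
Proof.
move=> x0; apply: nondecreasing_cvgn_le; last exact: is_cvg_series_exp_coeff.
by apply: nondecreasing_series => k _ _; exact: exp_coeff_ge0.
Qed.

(** The k-th terms differ by at most k^3 z^k / (k! N), and k^3 <= 8^k turns the sum into an
    exponential series at 8z. *)
Lemma Phi_dist n z : 0 <= z -> `|Phi n.+1 z - besselB z| <= expR (8 * z) * n.+1%:R^-1.
Proof.
move=> z0; have N0 : 0 < NN n.+1 by rewrite mulr_gt0 ?ltr0n.
have cS : pseries (bess R) z @ \oo --> besselB z by exact: (@is_cvg_entire _ _ z (entire_bess R)).
have cD : (fun m => `|Phi n.+1 z - pseries (bess R) z m|) @ \oo -->
    `|Phi n.+1 z - besselB z|.
  apply: cvg_norm.
  have h1 : (fun m : nat => Phi n.+1 z) @ \oo --> Phi n.+1 z by apply: cvg_cst.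
  exact: (cvgB h1 cS).
apply: (@cvgr_to_le nat \oo _ R _ _ _ cD).
near=> m.
have nm : (n.+1 < m)%N by near: m; exact: nbhs_infty_gt.
rewrite (PhiE z _ nm) // /pseries /series /= -sumrB.
rewrite (le_trans (ler_norm_sum _ _ _)) //.
apply: (@le_trans _ _ (\sum_(0 <= k < m) exp_coeff (8 * z) k * (NN n.+1)^-1)).
  apply: ler_sum => k _; rewrite -mulrBl -{2}[bess R k]mulr1 -mulrBr.
  rewrite normrM [`|bess R k * _|]normrM [`|z ^+ k|]normrX (ger0_norm z0).
  have [/andP[c0 c1] _] := @mhcoef_itv n.+1 k isT.
  have cge := @mhcoef_ge n.+1 k isT.
  rewrite distrC [`|1 - _|]ger0_norm ?subr_ge0 //.
  have k8 : k%:R ^+ 3 <= 8 ^+ k :> R.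
    rewrite -!natrX ler_nat (_ : 8 = 2 ^ 3)%N // -expnM mulnC expnM leq_exp2r //.
    by rewrite ltnW // ltn_expl.
  rewrite /exp_coeff /= exprMn.
  have := @bess_le R k; have := normr_ge0 (bess R k).
  have zk : 0 <= z ^+ k by rewrite exprn_ge0.
  have d1 : 1 - mhcoef n.+1 k <= 8 ^+ k / NN n.+1.
    rewrite lerBlDl -lerBlDr (le_trans _ cge) // lerD2l lerN2.
    by rewrite ler_wpM2r // invr_ge0 ltW.
  move=> b0 b1.
  have -> : 8 ^+ k * z ^+ k / k`!%:R / NN n.+1 = (k`!%:R)^-1 * (8 ^+ k / NN n.+1) * z ^+ k.
    by ring.
  by rewrite ler_wpM2r //; apply: ler_pM => //; rewrite subr_ge0.
rewrite -mulr_suml ler_pM ?sumr_ge0 ?invr_ge0 ?(ltW N0) // => [k _||].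
- by rewrite exp_coeff_ge0 // mulr_ge0.
- by apply: series_exp_le; rewrite mulr_ge0.
- by rewrite lef_pV2 ?posrE ?ltr0n // ler_peMr // ler1n.
Unshelve. all: by end_near. Qed.

(** The head of the increasing list of nodes is a least root, so [xget] does not fall back on its
    default. *)
Lemma GLp0P n : [/\ root (Ltilde R n.+1) (GLp0 n.+1), 0 < GLp0 n.+1 :> R, GLp0 n.+1 < 1 :> R &
  forall q : R, root (Ltilde R n.+1) q -> GLp0 n.+1 <= q].
Proof.
suff [p [rp pmin]] : exists p : R, GLsupp n.+1 p /\ forall q, GLsupp n.+1 q -> p <= q.
  rewrite /GLp0; case: xgetP => [x _ [rx xmin]|/(_ p)]; last by case.
  have : x \in GLnodes R n.+1 by rewrite mem_GLnodes.
  by move=> /GLnodes_itv /andP[x0 x1].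
have := size_GLnodes R n.+1; have := sorted_GLnodes R n.+1; have := @mem_GLnodes R n.+1.
case: (GLnodes R n.+1) => [//|x s] xs so _.
exists x; split; first by rewrite /GLsupp /= -xs mem_head.
move=> q; rewrite /GLsupp /= -xs in_cons => /orP[/eqP -> //|qs].
by rewrite ltW // (allP (order_path_min lt_trans so)).
Qed.

Local Notation z1 := (bessel_zero R).

Lemma cvg_GLp0 : (fun n => GLp0 n.+1 * NN n.+1) @ \oo --> z1.
Proof.
have z10 := bessel_zero_gt0 R; have [_ _ Bpos] := j1_spec R; rewrite -/z1 in z10 Bpos.
apply/cvgrPdist_lt => e e0.
have harm (C d : R) : 0 < d -> \forall n \near \oo, C * n.+1%:R^-1 < d.
  move=> d0; have h : (fun n => C * harmonic n) @ \oo --> C * 0.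
    by apply: cvgMl_tmp; exact: cvg_harmonic.
  by rewrite mulr0 in h; exact: (cvgr_lt _ h).
pose d := Num.min (e / 2) (z1 / 2).
have d0 : 0 < d by rewrite lt_min !divr_gt0.
have de : d <= e / 2 by rewrite ge_min lexx.
have dz : d <= z1 / 2 by rewrite ge_min lexx orbT.
have Ba : 0 < besselB (z1 - d) by apply: Bpos; lra.
have [z2 /andP[z12 z2e] Bz2] := besselB_neg e0; rewrite -/z1 in z12 z2e.
near=> n.
have h1 : expR (8 * z1) * n.+1%:R^-1 < besselB (z1 - d) by near: n; exact: harm.
have h2 : expR (8 * z2) * n.+1%:R^-1 < - besselB z2.
  by near: n; apply: harm; rewrite oppr_gt0.
have N0 : 0 < NN n.+1 by rewrite mulr_gt0 ?ltr0n.
have [rp p0 p1 pmin] := GLp0P n.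
set x := GLp0 n.+1 * NN n.+1.
have x0 : 0 < x by rewrite mulr_gt0.
have Phix : Phi n.+1 x = 0.
  by rewrite /Phi /x mulfK ?gt_eqF // (eqP rp) mul0r.
(* On [0, z1 - d] B is at least B(z1 - d), which by [h1] exceeds the error bound, so [Phi] has no
   zero there. *)
have lo : z1 - d < x.
  rewrite ltNge; apply/negP => xle.
  have := @Phi_dist n x (ltW x0); rewrite Phix sub0r normrN => hx.
  have := @besselB_le R x (z1 - d); rewrite -/z1 (ltW x0) xle => /(_ isT) hB.
  have {}hB : besselB (z1 - d) <= besselB x by apply: hB; lra.
  have := le_trans (ler_norm _) hx; apply/negP; rewrite -ltNge.
  apply: lt_le_trans hB; apply: le_lt_trans h1.
  by rewrite ler_wpM2r ?invr_ge0 // ler_expR; lra.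
have hi : x <= z2.
  have z20 : 0 < z2 by lra.
  have hP := le_lt_trans (ler_norm _) (le_lt_trans (@Phi_dist n z2 (ltW z20)) h2).
  have {}hP : Phi n.+1 z2 < 0 by lra.
  (* [Phi] is negative at z2, so Ltilde changes sign between 0 and z2 / N; the root in between is an
     upper bound for the smallest node. *)
  have neg : (Ltilde R n.+1).[0] * (Ltilde R n.+1).[z2 / NN n.+1] < 0.
    have -> : (Ltilde R n.+1).[z2 / NN n.+1] = Phi n.+1 z2 * (Ltilde R n.+1).[0].
      by rewrite /Phi divfK // Ltilde_at0_neq0.
    rewrite mulrCA nmulr_rlt0 // -expr2 exprn_even_gt0 //=.
    exact: Ltilde_at0_neq0.
  have [|y yI ry] := poly_ivtoo _ neg; first by rewrite divr_ge0 // ltW.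
  rewrite /x -ler_pdivlMr // (le_trans (pmin _ ry)) // ltW //.
  by rewrite (itvP yI).
by rewrite ltr_norml; apply/andP; lra.
Unshelve. all: by end_near. Qed.

Lemma cvg_ratio1 : (fun n => n.+1%:R / n.+2%:R : R) @ \oo --> (1 : R).
Proof.
have -> : (fun n => n.+1%:R / n.+2%:R : R) = (fun n => 1 - harmonic n.+1).
  apply/funext => n /=; rewrite (_ : n.+1%:R = n.+2%:R - 1 :> R).
    by rewrite mulrBl divff ?pnatr_eq0 // mul1r.
  by rewrite -[n.+2%:R]natr1 addrK.
have h1 : (fun n : nat => 1 : R) @ \oo --> (1 : R) by apply: cvg_cst.
have h2 : (fun n => @harmonic R n.+1) @ \oo --> (0 : R).
  by rewrite (cvg_shiftS (@harmonic R)); exact: cvg_harmonic.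
by rewrite -[X in _ --> X]subr0; exact: (cvgB h1 h2).
Qed.

Lemma cvg_sigma_GLp0 :
  (fun n => sigma (GLp0 n.+1) / (n.+1.*2)%:R) @ \oo --> (j1^-1 : R).
Proof.
have [j0 _ _] := j1_spec R; have z10 := bessel_zero_gt0 R; rewrite -/z1 in z10.
pose u n : R := GLp0 n.+1 * NN n.+1.
have uz : u @ \oo --> z1 by exact: cvg_GLp0.
(* With p the smallest node, [c1] is the limit of p c^2 and [c2] that of p; [c3] then gives (1 - p)
   / (p c^2), the square of the required quotient. *)
have c1 : (fun n => u n * (n.+1%:R / n.+2%:R) * 4) @ \oo --> z1 * 1 * 4.
  by apply: cvgMr_tmp; apply: cvgM => //; exact: cvg_ratio1.
have c2 : (fun n => u n * (harmonic n * harmonic n.+1)) @ \oo --> z1 * (0 * 0 : R).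
  apply: cvgM => //; apply: cvgM; first exact: cvg_harmonic.
  by rewrite (cvg_shiftS (@harmonic R)); exact: cvg_harmonic.
have c3 : (fun n => (1 - u n * (harmonic n * harmonic n.+1)) /
    (u n * (n.+1%:R / n.+2%:R) * 4)) @ \oo --> (1 - z1 * (0 * 0)) / (z1 * 1 * 4).
  apply: cvgM.
    have h1 : (fun n : nat => 1 : R) @ \oo --> (1 : R) by apply: cvg_cst.
    exact: (cvgB h1 c2).
  by apply: cvgV => //; rewrite mulr1 mulf_neq0 ?pnatr_eq0 // gt_eqF.
have c4 := continuous_cvg _ (@sqrt_continuous R _) c3.
have E : Num.sqrt ((1 - z1 * (0 * 0)) / (z1 * 1 * 4)) = j1^-1 :> R.
  have -> : (1 - z1 * (0 * 0)) / (z1 * 1 * 4) = j1^-1 ^+ 2 :> R.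
    by rewrite /bessel_zero; field; rewrite gt_eqF.
  by rewrite sqrtr_sqr ger0_norm // invr_ge0 ltW.
rewrite E in c4.
suff -> : (fun n => sigma (GLp0 n.+1) / (n.+1.*2)%:R) = (fun n : nat => Num.sqrt
  ((1 - u n * (harmonic n * harmonic n.+1)) / (u n * (n.+1%:R / n.+2%:R) * 4)) : R) by exact: c4.
apply/funext => n.
have [_ p0 p1 _] := GLp0P n.
have n1 : n.+1%:R != 0 :> R by rewrite pnatr_eq0.
have n2 : n.+2%:R != 0 :> R by rewrite pnatr_eq0.
rewrite /sigma /=.
have -> : n.+1.*2%:R^-1 = Num.sqrt ((n.+1.*2%:R : R) ^- 2).
  by rewrite sqrtrV ?sqr_ge0 // sqrtr_sqr ger0_norm.
rewrite -sqrtrM ?divr_ge0 ?ltW ?subr_gt0 //; congr Num.sqrt.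
rewrite /u /harmonic /= -muln2 natrM.
move: n1 n2 p0; move: (n.+1%:R) (n.+2%:R) (GLp0 n.+1) => a b p a0 b0 p0.
by field; rewrite a0 b0 gt_eqF.
Qed.

End MehlerHeine.

(** * The inverse of t r(t) *)

Section InverseOfTr.
Variable R : realType.
Implicit Types t y : R.

Definition trfun t : R := (expR t - 1 - t) / t.

Lemma trfunE t : 0 < t -> t * rfun t = trfun t.
Proof. by move=> t0; rewrite /rfun /trfun; field; rewrite gt_eqF. Qed.

(** The derivative is (t e^t - e^t + 1) / t^2, and its numerator is e^t (e^(-t) - (1 - t)) > 0. *)
Lemma trfun_incr s t : 0 < s -> s < t -> trfun s < trfun t.
Proof.
move=> s0 st; have t0 := lt_trans s0 st.
rewrite -ltrN2.
apply: (@derive_lt0_lt _ (fun u => - trfun u)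
   (fun u => - ((u * expR u - expR u + 1) / u ^+ 2)) _ _ st).
  move=> x /andP[sx _]; have x0 : x != 0 by rewrite gt_eqF // (lt_le_trans s0).
  have H1 : is_derive x 1 (fun u : R => expR u - 1 - u) (expR x - 0 - 1).
    exact: (is_deriveB (is_deriveB (is_derive_expR x) (is_derive_cst (1 : R) x 1)) (is_derive_id x 1)).
  have H2 : is_derive x 1 (fun u : R => u^-1) (- x ^- 2 *: 1) by exact: is_deriveV.
  have H3 := is_deriveN (is_deriveM H1 H2).
  apply: (@is_derive_eq _ _ _ _ _ _ _ _ H3).
  by rewrite /GRing.scale /=; field.
move=> x /andP[sx _]; have x0 := lt_trans s0 sx.
rewrite oppr_lt0 divr_gt0 ?exprn_gt0 //.
have : 1 + - x < expR (- x) by rewrite expR_gt1Dx // oppr_eq0 gt_eqF.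
rewrite expRN -(ltr_pM2r (expR_gt0 x)) mulVf ?gt_eqF ?expR_gt0 //; lra.
Qed.

Lemma trfun_small e : 0 < e -> exists2 t, 0 < t & trfun t < e.
Proof.
(* The witness makes e^t - 1 equal to e/2; then e^(-t) > 1 - t gives e/2 - t < t e/2. *)
move=> e0; exists (ln (1 + e / 2)); first by rewrite ln_gt0 // ltrDl divr_gt0.
set t := ln _.
have t0 : 0 < t by rewrite ln_gt0 // ltrDl divr_gt0.
have et : expR t = 1 + e / 2 by rewrite lnK // posrE; lra.
rewrite /trfun ltr_pdivrMr //.
have : 1 + - t < expR (- t) by rewrite expR_gt1Dx // oppr_eq0 gt_eqF.
rewrite expRN -(ltr_pM2r (expR_gt0 t)) mulVf ?gt_eqF ?expR_gt0 // et => H.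
by nra.
Qed.

Lemma trfun_large M : exists2 t, 0 < t & M < trfun t.
Proof.
(* The factor 6 lets the cubic term t^3 / 6 of the exponential dominate (M + 1) t. *)
pose t := 6 * (`|M| + 1); have M0 := normr_ge0 M.
have t0 : 0 < t by rewrite /t; lra.
exists t => //; rewrite /trfun ltr_pdivlMr //.
have := expR_ge1Dxn 2 (ltW t0); rewrite (_ : 3`! = 6%N) // => h1.
have h2 := ler_norm M; have k0 : 1 <= `|M| + 1 by lra.
have h3 : M * t + t <= 6 * (`|M| + 1) ^+ 2 by rewrite /t; nra.
have h4 : t ^+ 3 / 6 = 36 * (`|M| + 1) ^+ 3 by rewrite /t; field.
have h5 : (`|M| + 1) ^+ 2 <= (`|M| + 1) ^+ 3 by rewrite ler_weXn2l.
have h6 : 1 <= (`|M| + 1) ^+ 2 by rewrite exprn_ege1.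
by rewrite h4 in h1; lra.
Qed.

Lemma trfun_continuous t : 0 < t -> {for t, continuous trfun}.
Proof.
move=> t0; apply: cvgM.
  apply: cvgB; first apply: cvgB; [exact: continuous_expR|exact: cvg_cst|exact: cvg_id].
by apply: cvgV; [rewrite gt_eqF|exact: cvg_id].
Qed.

Lemma trfun_surj y : 0 < y -> exists2 t, 0 < t & trfun t = y.
Proof.
move=> y0; have [a a0 ha] := trfun_small y0; have [b b0 hb] := trfun_large y.
have ab : a < b.
  rewrite ltNge le_eqVlt; apply/negP => /orP[/eqP ba|/(trfun_incr b0)].
    by move: hb; rewrite ba; lra.
  by lra.
have cont : {within `[a, b], continuous trfun}.
  apply: continuous_in_subspaceT => x; rewrite inE /= in_itv /= => /andP[ax _].
  by apply: trfun_continuous; apply: lt_le_trans ax.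
have [|c] := IVT (ltW ab) cont (v := y).
  by rewrite ge_min le_max (ltW ha) (ltW hb) orbT.
rewrite in_itv /= => /andP[ac _] hc; exists c => //.
exact: lt_le_trans ac.
Qed.

Lemma trinvP y : 0 < y -> 0 < trinv y /\ trfun (trinv y) = y.
Proof.
move=> y0; have [t t0 ht] := trfun_surj y0; rewrite /trinv.
case: xgetP => [x _ [x0]|/(_ t)]; first by rewrite trfunE.
by case; rewrite /= trfunE.
Qed.

Lemma trinv_lt t y : 0 < t -> 0 < y -> trfun t < y -> t < trinv y.
Proof.
move=> t0 y0 hty; have [x0 hx] := trinvP y0.
rewrite ltNge le_eqVlt; apply/negP => /orP[/eqP xt|/(trfun_incr x0)].
  by move: hty; rewrite -xt hx ltxx.
by rewrite hx; lra.
Qed.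

Lemma trinv_gt t y : 0 < t -> 0 < y -> y < trfun t -> trinv y < t.
Proof.
move=> t0 y0 hty; have [x0 hx] := trinvP y0.
rewrite ltNge le_eqVlt; apply/negP => /orP[/eqP xt|/(trfun_incr t0)].
  by move: hty; rewrite xt hx ltxx.
by rewrite hx; lra.
Qed.

Lemma cvg_trinv (u : nat -> R) y : 0 < y -> u @ \oo --> y ->
  (fun n => trinv (u n)) @ \oo --> trinv y.
Proof.
move=> y0 uy; have [x0 hx] := trinvP y0; set x := trinv y in x0 hx *.
apply/cvgrPdist_lt => e e0.
(* The cap x/2 keeps x - d positive, where [trfun] is increasing. *)
pose d := Num.min e (x / 2).
have d0 : 0 < d by rewrite lt_min e0 divr_gt0.
have de : d <= e by rewrite ge_min lexx.
have dx : d <= x / 2 by rewrite ge_min lexx orbT.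
have a0 : 0 < x - d by lra.
have b0 : 0 < x + d by lra.
have ha : trfun (x - d) < y by rewrite -hx trfun_incr //; lra.
have hb : y < trfun (x + d) by rewrite -[X in X < _]hx trfun_incr //; lra.
near=> n.
have u0 : 0 < u n by near: n; exact: (cvgr_gt _ uy).
have h1 : trfun (x - d) < u n by near: n; exact: (cvgr_gt _ uy).
have h2 : u n < trfun (x + d) by near: n; exact: (cvgr_lt _ uy).
have := trinv_lt a0 u0 h1; have := trinv_gt b0 u0 h2.
by rewrite ltr_norml => t1 t2; apply/andP; lra.
Unshelve. all: by end_near. Qed.

Lemma cvg_trinv_pinfty (u : nat -> R) : u @ \oo --> +oo ->
  (fun n => trinv (u n)) @ \oo --> +oo.
Proof.
move=> uy; apply/cvgryPgt => A.
have A0 : 0 < `|A| + 1 by rewrite ltr_wpDl.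
near=> n.
have u0 : 0 < u n by near: n; by move/cvgryPgt: uy; apply.
have u1 : trfun (`|A| + 1) < u n by near: n; by move/cvgryPgt: uy; apply.
have := trinv_lt A0 u0 u1; have := ler_norm A; lra.
Unshelve. all: by end_near. Qed.

End InverseOfTr.

(** * Limits of products and quotients with unbounded sequences *)

Section LimitHelpers.
Variable R : realType.

Lemma cvg_pinftyM (u v : nat -> R) (l : R) : u @ \oo --> +oo -> v @ \oo --> l ->
  0 < l -> (fun n => u n * v n) @ \oo --> +oo.
Proof.
move=> uy vl l0; apply/cvgryPgt => A.
near=> n.
have v1 : l / 2 < v n by near: n; apply: (cvgr_gt _ vl); lra.
have u1 : 2 * `|A| / l < u n by near: n; move/cvgryPgt: uy; apply.
have A0 := normr_ge0 A.
have a0 : 0 <= 2 * `|A| / l by rewrite divr_ge0 ?mulr_ge0 // ltW.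
apply: (le_lt_trans (ler_norm A)).
have -> : `|A| = (2 * `|A| / l) * (l / 2) by field; rewrite gt_eqF.
by apply: ltr_pM => //; lra.
Unshelve. all: by end_near. Qed.

Lemma cvg_bounded_div (u v : nat -> R) (M : R) : (forall n, `|u n| <= M) ->
  v @ \oo --> +oo -> (fun n => u n / v n) @ \oo --> (0 : R).
Proof.
move=> uM vy; have M0 : 0 <= M := le_trans (normr_ge0 _) (uM 0%N).
apply/cvgrPdist_lt => e e0; near=> n.
have v1 : M / e < v n by near: n; move/cvgryPgt: vy; apply.
have v0 : 0 < v n by rewrite (le_lt_trans _ v1) // divr_ge0 // ltW.
rewrite sub0r normrN normrM normfV (gtr0_norm v0) ltr_pdivrMr //.
by rewrite (le_lt_trans (uM n)) // mulrC -ltr_pdivrMr.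
Unshelve. all: by end_near. Qed.

End LimitHelpers.

(* Even c >= 2 are enumerated as c = 2 nu with nu = n.+1, n : nat; the
   parameters eta1, eta2, eps1, eps2 are functions of c. *)
Theorem theorem5 (R : realType) (eta1 eta2 eps1 eps2 : nat -> R) (eta eta' : R) :
  (forall n : nat, let c := (n.+1).*2 in
     0 < eta1 c /\ 0 < eta2 c /\ 0 < eps1 c < 1 /\ 0 < eps2 c < 1) ->
  (fun n : nat => eta1 (n.+1).*2) @ \oo --> eta ->
  0 < eta ->
  (fun n : nat => eta2 (n.+1).*2) @ \oo --> +oo ->
  (fun n : nat => eta2 (n.+1).*2 / ((n.+1).*2)%:R) @ \oo --> eta' ->
  0 <= eta' ->
  eta + eta' < 1 ->
  (exists M : R, forall n : nat, let c := (n.+1).*2 in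
     `| ln (1 / eps2 c) / ln (1 / eps1 c) | <= M) ->
  (fun n : nat =>
     let nu := n.+1 in
     let c := nu.*2 in
     let cR : R := c%:R in
     let Rc := calRmin nu in
     let psi1 := sigma (GLp0 nu) in
     let psi2 := sigma (GLp0 nu) in
     let x1 := trinv (eta1 c * Rc * psi1 / cR) in
     let x2 := trinv (eta2 c * Rc * psi1 / cR) in
     let A1 := cR / ((1 - eta1 c - eta2 c / cR) * Rc) * (psi2 / x1) * ln (1 / eps1 c) in
     let A2 := cR / ((1 - eta1 c - eta2 c / cR) * Rc) * (psi2 / x2) * ln (1 / eps2 c) in
     let m := A1 + A2 in
     let xinf := trinv (eta / (pi * j1)) in
     m / (pi / ((1 - eta - eta') * j1 * xinf) * cR ^+ 2 * ln (1 / eps1 c)))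
  @ \oo --> (1 : R).
Proof.
move=> par e1 eta0 e2 e2c _ lt1 [M lnM].
have [j0 _ _] := j1_spec R; have p0 := @pi_gt0 R.
(* Since psi / c is [s], the arguments of [trinv] become eta_i [r] [s], where [r] tends to 1/pi and
   [s] to 1/j1. *)
pose r n : R := calRmin n.+1.
pose s n : R := sigma (GLp0 n.+1) / (n.+1.*2)%:R.
have rl : r @ \oo --> pi^-1 by exact: cvg_calRmin.
have sl : s @ \oo --> j1^-1 by exact: cvg_sigma_GLp0.
have rsl : (fun n => r n * s n) @ \oo --> pi^-1 / j1 by exact: cvgM.
have rs0 : 0 < pi^-1 / j1 :> R by rewrite divr_gt0 // invr_gt0.
pose y1 n := eta1 n.+1.*2 * (r n * s n).
pose y2 n := eta2 n.+1.*2 * (r n * s n).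
set xinf := trinv (eta / (pi * j1)).
have yl0 : 0 < eta / (pi * j1) by rewrite divr_gt0 // mulr_gt0.
have x0 : 0 < xinf by have [] := trinvP yl0.
have x1l : (fun n => trinv (y1 n)) @ \oo --> xinf.
  apply: cvg_trinv => //.
  suff -> : eta / (pi * j1) = eta * (pi^-1 / j1) by exact: cvgM.
  by rewrite invfM.
have x2l : (fun n => trinv (y2 n)) @ \oo --> +oo.
  by apply: cvg_trinv_pinfty; exact: cvg_pinftyM rsl rs0.
pose k n := 1 - eta1 n.+1.*2 - eta2 n.+1.*2 / (n.+1.*2)%:R.
have kl : k @ \oo --> 1 - eta - eta'.
  have h1 : (fun n : nat => 1 : R) @ \oo --> (1 : R) by apply: cvg_cst.
  exact: (cvgB (cvgB h1 e1) e2c).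
have k0 : 1 - eta - eta' != 0 by rewrite gt_eqF //; lra.
pose q n := ln (1 / eps2 n.+1.*2) / ln (1 / eps1 n.+1.*2).
(* After division by log (1/eps1) the share of A2 is a bounded ratio over x2, which tends to
   infinity. *)
have ql : (fun n => q n / trinv (y2 n)) @ \oo --> (0 : R).
  exact: (@cvg_bounded_div _ q _ M).
pose C : R := (1 - eta - eta') * j1 * xinf / pi.
have main : (fun n => (k n)^-1 * (r n)^-1 * s n *
    ((trinv (y1 n))^-1 + q n / trinv (y2 n)) * C) @ \oo -->
    (1 - eta - eta')^-1 * (pi^-1)^-1 * j1^-1 * (xinf^-1 + 0) * C.
  apply: cvgMr_tmp; apply: cvgM; last first.
    by apply: cvgD => //; apply: cvgV => //; rewrite gt_eqF.
  apply: cvgM => //; apply: cvgM; first exact: cvgV.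
  by apply: cvgV => //; rewrite invr_neq0 // gt_eqF.
have lim1 : (1 - eta - eta')^-1 * (pi^-1)^-1 * j1^-1 * (xinf^-1 + 0) * C = 1.
  rewrite /C addr0 invrK; move: k0 (lt0r_neq0 p0) (lt0r_neq0 j0) (lt0r_neq0 x0).
  move: (1 - eta - eta') (pi : R) (j1 : R) (xinf : R) => K P J X K0 P0 J0 X0.
  by field; rewrite K0 P0 J0 X0.
rewrite lim1 in main.
(* For every n the ratio equals the expression in [main]: c psi2 = c^2 [s], so c^2 and log (1/eps1)
   cancel, and [C] is what remains of the denominator. *)
rewrite [X in X @ \oo --> _](_ : _ = (fun n => (k n)^-1 * (r n)^-1 * s n *
    ((trinv (y1 n))^-1 + q n / trinv (y2 n)) * C)); first exact: main.
apply/funext => n /=; rewrite -/xinf -/(k n) -/(r n).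
have -> : eta1 n.+1.*2 * r n * sigma (GLp0 n.+1) / n.+1.*2%:R = y1 n.
  by rewrite /y1 /s !mulrA.
have -> : eta2 n.+1.*2 * r n * sigma (GLp0 n.+1) / n.+1.*2%:R = y2 n.
  by rewrite /y2 /s !mulrA.
have l0 : ln (1 / eps1 n.+1.*2) != 0.
  have [_ [_ [/andP[ep0 ep1] _]]] := par n.
  by rewrite gt_eqF // ln_gt0 // div1r invf_gt1.
have c0 : n.+1.*2%:R != 0 :> R by rewrite pnatr_eq0 double_eq0.
rewrite /C /s /q.
move: c0 l0; move: (ln (1 / eps1 _)) (ln (1 / eps2 _)) => l1 l2.
rewrite invfM; move: (k n)^-1 (r n)^-1 (trinv (y1 n))^-1 (trinv (y2 n))^-1 => a b d f.
move: (n.+1.*2%:R) (sigma _) => c g c0 l0.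
rewrite !invfM invrK; move: (pi^-1) => P.
by field; rewrite l0 c0 (gt_eqF x0) (gt_eqF j0).
Qed.
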